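(* Let $\ell,m\in\mathbb{Z}_{>0}$ and $a\in\mathbb{C}\setminus\{0\}$. The linear map $$R=\sum_{\nu=0}^{\min\{\ell,m\}}(-1)^\nu q^{-\nu(\ell+m-\nu+1)}R_{\ell+m-2\nu}$$ is an intertwiner between the $U'_q(L(\mathfrak{sl}_2))$-modules $V(\ell,a)\otimes V(m)$ and $V(m)\otimes V(\ell,a)$, i.e. $R$ is a nonzero linear map $V(\ell,a)\otimes V(m)\to V(m)\otimes V(\ell,a)$ with $R\Delta(\xi)=\Delta(\xi)R$ for all $\xi\in U'_q(L(\mathfrak{sl}_2))$. Any other intertwiner is a scalar multiple of $R$.
   Context: The ground field is $\mathbb{C}$, and $q\in\mathbb{C}$ is nonzero and not a root of unity. Notation: $[X,Y]=XY-YX$, $[X,Y]_q=qXY-q^{-1}YX$, $[X,Y]_{q^{-1}}=q^{-1}XY-qYX$, $[t]=(q^t-q^{-t})/(q-q^{-1})$, $[t]!=[t][t-1]\cdots[1]$, $[0]!=1$. The algebra $U'=U'_q(L(\mathfrak{sl}_2))$ is the subalgebra of the $U_q(\mathfrak{sl}_2)$-loop algebra $U_q(L(\mathfrak{sl}_2))$ (with Chevalley generators $e_i^\pm,k_i^{\pm1}$, $i=0,1$, and $k_0k_1=1$) generated by $e_0^+,e_1^+,e_1^-,k_0^{\pm1},k_1^{\pm1}$. It is the associative unital $\mathbb{C}$-algebra with these generators and defining relations $k_0k_1=k_1k_0=1$, $k_ik_i^{-1}=k_i^{-1}k_i=1$, $k_0e_0^+k_0^{-1}=q^2e_0^+$,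 $k_1e_1^\pm k_1^{-1}=q^{\pm2}e_1^\pm$, $k_1e_0^+k_1^{-1}=q^{-2}e_0^+$, $k_0e_1^\pm k_0^{-1}=q^{\mp2}e_1^\pm$, $[e_1^+,e_1^-]=\frac{k_1-k_1^{-1}}{q-q^{-1}}$, $[e_0^+,e_1^-]=0$, and $[e_i^+,[e_i^+,[e_i^+,e_j^+]_q]_{q^{-1}}]=0$ for $i\ne j$ in $\{0,1\}$. Tensor products of $U'$-modules are $U'$-modules via the coproduct $\Delta(k_i^{\pm1})=k_i^{\pm1}\otimes k_i^{\pm1}$, $\Delta(e_i^+)=k_i\otimes e_i^++e_i^+\otimes1$ $(i=0,1)$, $\Delta(e_1^-k_1)=k_1\otimes e_1^-k_1+e_1^-k_1\otimes1$. Evaluation modules: $V(\ell,a)$ is the $(\ell+1)$-dimensional $U'$-module with basis $v_0,\ldots,v_\ell$ and action $k_0v_i=q^{2i-\ell}v_i$, $k_1v_i=q^{\ell-2i}v_i$, $e_0^+v_i=aq[i+1]v_{i+1}$, $e_1^+v_i=[\ell-i+1]v_{i-1}$, $e_1^-v_i=[i+1]v_{i+1}$, where $v_{-1}=v_{\ell+1}=0$. $V(m)=V(m,0)$ is given by the same formulas with $\ell$ replaced by $m$, $a=0$, and basis denoted $v'_0,\ldots,v'_m$. Let $\mathcal{U}$ be the subalgebra of $U'$ generated by $e_1^\pm,k_1^{\pm1}$; it is isomorphic to $U_q(\mathfrak{sl}_2)$. As $\mathcal{U}$-modules (via $\Delta$), $V(\ell,a)\otimes V(m)=\bigoplus_{\nu=0}^{\min\{\ell,m\}}\widetilde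 V(\ell+m-2\nu)$ and $V(m)\otimes V(\ell,a)=\bigoplus_{\nu=0}^{\min\{\ell,m\}}\widetilde V'(\ell+m-2\nu)$, where $\widetilde V(n)$ (resp. $\widetilde V'(n)$) is the unique irreducible $\mathcal{U}$-submodule isomorphic to the irreducible $(n+1)$-dimensional $\mathcal{U}$-module on which $k_1$ has eigenvalues $q^n,q^{n-2},\ldots,q^{-n}$. For $n=\ell+m-2\nu$, $0\le\nu\le\min\{\ell,m\}$, lowest weight vectors (killed by $e_1^-$, of $k_1$-eigenvalue $q^{-n}$) of $\widetilde V(n)$ and $\widetilde V'(n)$ are respectively $$\widetilde x_n=\sum_{j=0}^{\nu}(-1)^jq^{j(m-j+1)}[\ell-\nu+j]!\,[m-j]!\;v_{\ell-\nu+j}\otimes v'_{m-j},$$ $$\widetilde x'_n=\sum_{j=0}^{\nu}(-1)^jq^{j(\ell-j+1)}[m-\nu+j]!\,[\ell-j]!\;v'_{m-\nu+j}\otimes v_{\ell-j}.$$ For such $n$, $R_n: V(\ell,a)\otimes V(m)\to\widetilde V'(n)\subseteq V(m)\otimes V(\ell,a)$ denotes the unique linear map that commutes with the action of $\mathcal{U}$ and sends $\widetilde x_n$ to $\widetilde x'_n$ (it vanishes on $\widetilde V(t)$ for $t\ne n$ and maps $\widetilde V(n)$ isomorphically onto $\widetilde V'(n)$). *)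

(* Defs.v *)
From HB Require Import structures.
From mathcomp Require Import all_boot all_order all_algebra.
From mathcomp Require Import generic_quotient mxtens complex ring zify.
From mathcomp Require Import boolp classical_sets reals.

Set Implicit Arguments.
Unset Strict Implicit.
Unset Printing Implicit Defensive.
Import GRing.Theory.
Local Open Scope ring_scope.
Local Open Scope quotient_scope.

Definition q_generic (F : fieldType) (q : F) : Prop :=
  q != 0 /\ forall n : nat, (0 < n)%N -> q ^+ n != 1.

Section QNumbers.
Variables (F : fieldType) (q : F).

Definition qnum (t : int) : F := (q ^ t - q ^ (- t)) / (q - q^-1).
Definition qfact (t : nat) : F := \prod_(1 <= i < t.+1) qnum i%:Z.

Lemma qnum0 : qnum 0 = 0. Proof. by rewrite /qnum oppr0 subrr mul0r. Qed.

End QNumbers.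

(* The indices 0 and 1 of the Chevalley generators are false and true:        *)
(* GK i = k_i, GKV i = k_i^-1, GE i = e_i^+ and GEm = e_1^-.                  *)
Inductive gen := GK of bool | GKV of bool | GE of bool | GEm.

(* Noncommutative polynomial expressions in the generators over F.            *)
Inductive expr (F : Type) :=
  | Gen of gen
  | Cst of F
  | Add of expr F & expr F
  | Mul of expr F & expr F.
Arguments Gen {F}.

Section Presentation.
Variables (F : fieldType) (q : F).
Local Notation expr := (expr F).

Local Notation k i := (@Gen F (GK i)).
Local Notation kV i := (@Gen F (GKV i)).
Local Notation e i := (@Gen F (GE i)).
Local Notation e1m := (@Gen F GEm).
Local Notation "x ⊙ y" := (Mul x y) (at level 40, left associativity).

(* c x y - c^-1 y x; this is [x, y] for c = 1 and [x, y]_c for c = q, q^-1.   *)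
Definition bracket (c : F) (x y : expr) : expr :=
  Add (Cst c ⊙ (x ⊙ y)) (Cst (- c^-1) ⊙ (y ⊙ x)).

Inductive Urel : expr -> expr -> Prop :=
  | Urel_kk i : Urel (k i ⊙ k (~~ i)) (Cst 1)
  | Urel_kkV i : Urel (k i ⊙ kV i) (Cst 1)
  | Urel_kVk i : Urel (kV i ⊙ k i) (Cst 1)
  | Urel_ke i : Urel (k i ⊙ e i ⊙ kV i) (Cst (q ^+ 2) ⊙ e i)
  | Urel_ke' i : Urel (k i ⊙ e (~~ i) ⊙ kV i) (Cst (q ^- 2) ⊙ e (~~ i))
  | Urel_k1em : Urel (k true ⊙ e1m ⊙ kV true) (Cst (q ^- 2) ⊙ e1m)
  | Urel_k0em : Urel (k false ⊙ e1m ⊙ kV false) (Cst (q ^+ 2) ⊙ e1m)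
  | Urel_e1em : Urel (bracket 1 (e true) e1m)
      (Cst (q - q^-1)^-1 ⊙ Add (k true) (Cst (-1) ⊙ kV true))
  | Urel_e0em : Urel (bracket 1 (e false) e1m) (Cst 0)
  | Urel_serre i :
      Urel (bracket 1 (e i) (bracket q^-1 (e i) (bracket q (e i) (e (~~ i)))))
           (Cst 0).

(* The smallest congruence containing Urel and the axioms of unital           *)
(* associative F-algebras.                                                    *)
Inductive Ueq : expr -> expr -> Prop :=
  | Ueq_rel x y : Urel x y -> Ueq x y
  | Ueq_refl x : Ueq x x
  | Ueq_sym x y : Ueq x y -> Ueq y x
  | Ueq_trans x y z : Ueq x y -> Ueq y z -> Ueq x z
  | Ueq_add x x' y y' : Ueq x x' -> Ueq y y' -> Ueq (Add x y) (Add x' y')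
  | Ueq_mul x x' y y' : Ueq x x' -> Ueq y y' -> Ueq (x ⊙ y) (x' ⊙ y')
  | Ueq_addA x y z : Ueq (Add x (Add y z)) (Add (Add x y) z)
  | Ueq_addC x y : Ueq (Add x y) (Add y x)
  | Ueq_add0 x : Ueq (Add (Cst 0) x) x
  | Ueq_addN x : Ueq (Add (Cst (-1) ⊙ x) x) (Cst 0)
  | Ueq_mulA x y z : Ueq (x ⊙ (y ⊙ z)) (x ⊙ y ⊙ z)
  | Ueq_mul1 x : Ueq (Cst 1 ⊙ x) x
  | Ueq_mulDl x y z : Ueq (Add x y ⊙ z) (Add (x ⊙ z) (y ⊙ z))
  | Ueq_mulDr x y z : Ueq (x ⊙ Add y z) (Add (x ⊙ y) (x ⊙ z))
  | Ueq_CstD c d : Ueq (Cst (c + d)) (Add (Cst c) (Cst d))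
  | Ueq_CstM c d : Ueq (Cst (c * d)) (Cst c ⊙ Cst d)
  | Ueq_CstC c x : Ueq (Cst c ⊙ x) (x ⊙ Cst c).

End Presentation.

HB.instance Definition _ (F : fieldType) := gen_eqMixin (expr F).
HB.instance Definition _ (F : fieldType) := gen_choiceMixin (expr F).

Section Algebra.
Variables (F : fieldType) (q : F).

Definition Ueqb : rel (expr F) := fun x y => `[< Ueq q x y >].

Fact Ueqb_equiv : equiv_class_of Ueqb.
Proof.
split=> [x|x y|y x z]; first exact/asboolP/Ueq_refl.
  by apply/asboolP/asboolP; exact: Ueq_sym.
by move=> /asboolP xy /asboolP yz; apply/asboolP/(Ueq_trans xy).
Qed.

Canonical Ueq_equiv := EquivRelPack Ueqb_equiv.

Definition U' := {eq_quot Ueq_equiv}.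
HB.instance Definition _ := Choice.on U'.

Definition U_pi (x : expr F) : U' := \pi_U' x.

Lemma U_piP x y : U_pi x = U_pi y <-> Ueq q x y.
Proof.
split=> [/eqP|xy]; last by apply/eqP; rewrite /U_pi eqmodE; exact/asboolP.
by rewrite /U_pi eqmodE => /asboolP.
Qed.

Lemma U_reprK x : U_pi (repr x) = x. Proof. exact: reprK. Qed.

Lemma U_repr x : Ueq q (repr (U_pi x)) x.
Proof. by apply/U_piP; rewrite U_reprK. Qed.

Lemma U_piW (P : U' -> Prop) : (forall x, P (U_pi x)) -> forall u, P u.
Proof. by move=> Px u; rewrite -(U_reprK u). Qed.

Definition U_add (u v : U') := U_pi (Add (repr u) (repr v)).
Definition U_mul (u v : U') := U_pi (Mul (repr u) (repr v)).
Definition U_cst (c : F) := U_pi (Cst c).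
Definition U_scale (c : F) (u : U') := U_mul (U_cst c) u.
Definition U_opp (u : U') := U_scale (-1) u.

Lemma U_piD x y : U_pi (Add x y) = U_add (U_pi x) (U_pi y).
Proof. by apply/U_piP/Ueq_add; apply/Ueq_sym/U_repr. Qed.

Lemma U_piM x y : U_pi (Mul x y) = U_mul (U_pi x) (U_pi y).
Proof. by apply/U_piP/Ueq_mul; apply/Ueq_sym/U_repr. Qed.

Fact U_addA : associative U_add.
Proof.
do 3![elim/U_piW=> ?]; rewrite -!U_piD; exact/U_piP/Ueq_addA.
Qed.
Fact U_addC : commutative U_add.
Proof. do 2![elim/U_piW=> ?]; rewrite -!U_piD; exact/U_piP/Ueq_addC. Qed.
Fact U_add0 : left_id (U_cst 0) U_add.
Proof. elim/U_piW=> ?; rewrite -!U_piD; exact/U_piP/Ueq_add0. Qed.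
Fact U_addN : left_inverse (U_cst 0) U_opp U_add.
Proof.
elim/U_piW=> ?; rewrite /U_opp /U_scale -U_piM -U_piD; exact/U_piP/Ueq_addN.
Qed.
HB.instance Definition _ :=
  GRing.isZmodule.Build U' U_addA U_addC U_add0 U_addN.

Fact U_mulA : associative U_mul.
Proof. do 3![elim/U_piW=> ?]; rewrite -!U_piM; exact/U_piP/Ueq_mulA. Qed.
Fact U_mul1 : left_id (U_cst 1) U_mul.
Proof. elim/U_piW=> ?; rewrite -!U_piM; exact/U_piP/Ueq_mul1. Qed.
Fact U_cstC c u : U_mul (U_cst c) u = U_mul u (U_cst c).
Proof. move: u; elim/U_piW=> ?; rewrite -!U_piM; exact/U_piP/Ueq_CstC. Qed.
Fact U_mulr1 : right_id (U_cst 1) U_mul.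
Proof. by move=> u; rewrite -U_cstC U_mul1. Qed.
Fact U_mulDl : left_distributive U_mul U_add.
Proof.
do 3![elim/U_piW=> ?]; rewrite -!(U_piD, U_piM); exact/U_piP/Ueq_mulDl.
Qed.
Fact U_mulDr : right_distributive U_mul U_add.
Proof.
do 3![elim/U_piW=> ?]; rewrite -!(U_piD, U_piM); exact/U_piP/Ueq_mulDr.
Qed.
HB.instance Definition _ :=
  GRing.Zmodule_isPzRing.Build U' U_mulA U_mul1 U_mulr1 U_mulDl U_mulDr.

Section Evaluation.
Variables (n : nat) (f : gen -> 'M[F]_n).

Fixpoint ev (x : expr F) : 'M[F]_n :=
  match x with
  | Gen g => f g
  | Cst c => c%:M
  | Add x y => ev x + ev y
  | Mul x y => ev x *m ev y
  end.

Definition satisfies_Urel := forall x y, Urel q x y -> ev x = ev y.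

Lemma ev_Ueq : satisfies_Urel -> forall x y, Ueq q x y -> ev x = ev y.
Proof.
move=> fP x y; elim=> {x y} //=.
- by move=> x y z _ -> _ ->.
- by move=> x x' y y' _ -> _ ->.
- by move=> x x' y y' _ -> _ ->.
- by move=> x y z; rewrite addrA.
- by move=> x y; rewrite addrC.
- by move=> x; rewrite raddf0 add0r.
- by move=> x; rewrite mul_scalar_mx scaleN1r addNr raddf0.
- by move=> x y z; rewrite mulmxA.
- by move=> x; rewrite mul1mx.
- by move=> x y z; rewrite mulmxDl.
- by move=> x y z; rewrite mulmxDr.
- by move=> c d; rewrite raddfD.
- by move=> c d; rewrite scalar_mxM.
- by move=> c x; rewrite scalar_mxC.
Qed.

End Evaluation.

(* The counit, used to show that U' is not the zero ring.                     *)
Definition counit_gen (g : gen) : 'M[F]_1 :=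
  match g with GK _ | GKV _ => 1%:M | GE _ | GEm => 0 end.

Fact counit_gen_rel : satisfies_Urel counit_gen.
Proof.
move=> x y [] /= *; rewrite ?(mulmx0, mul0mx, addr0, mulmx1) //.
- by rewrite raddfN /= subrr mulmx0.
- by rewrite raddf0.
- by rewrite raddf0.
Qed.

Fact U_oner_neq0 : (1 : U') != 0.
Proof.
apply/eqP => /U_piP /(ev_Ueq counit_gen_rel) /= /matrixP /(_ 0 0) /eqP.
by rewrite !mxE /= oner_eq0.
Qed.
HB.instance Definition _ := GRing.PzSemiRing_isNonZero.Build U' U_oner_neq0.

Fact U_scaleA a b (u : U') : U_scale a (U_scale b u) = U_scale (a * b) u.
Proof.
rewrite /U_scale U_mulA; congr U_mul; rewrite -U_piM; apply/U_piP.
exact/Ueq_sym/Ueq_CstM.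
Qed.
Fact U_scale1 : left_id 1 U_scale.
Proof. exact: U_mul1. Qed.
Fact U_scaleDr : right_distributive U_scale +%R.
Proof. by move=> c u v; exact: U_mulDr. Qed.
Fact U_scaleDl (u : U') : {morph U_scale^~ u : a b / a + b}.
Proof.
move=> a b; rewrite /U_scale -[RHS]U_mulDl; congr U_mul; rewrite -U_piD.
exact/U_piP/Ueq_CstD.
Qed.
HB.instance Definition _ :=
  GRing.Zmodule_isLmodule.Build F U' U_scaleA U_scale1 U_scaleDr U_scaleDl.

Fact U_scaleAl a (u v : U') : a *: (u * v) = (a *: u) * v.
Proof. exact: U_mulA. Qed.
HB.instance Definition _ :=
  GRing.LSemiModule_isLSemiAlgebra.Build F U' U_scaleAl.
Fact U_scaleAr a (u v : U') : a *: (u * v) = u * (a *: v).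
Proof.
by rewrite [LHS]U_mulA [RHS]U_mulA; congr U_mul; exact: U_cstC.
Qed.
HB.instance Definition _ := GRing.Lalgebra_isAlgebra.Build F U' U_scaleAr.

Definition ugen (g : gen) : U' := U_pi (Gen g).

(* The subalgebra generated by e_1^+, e_1^- and k_1^{±1}.                     *)
Inductive calU : U' -> Prop :=
  | calU_k1 : calU (ugen (GK true))
  | calU_k1V : calU (ugen (GKV true))
  | calU_e1p : calU (ugen (GE true))
  | calU_e1m : calU (ugen GEm)
  | calU_1 : calU 1
  | calU_scale c u : calU u -> calU (c *: u)
  | calU_add u v : calU u -> calU v -> calU (u + v)
  | calU_mul u v : calU u -> calU v -> calU (u * v).

(* A U'-module structure on 'cV[F]_n, matrices acting on columns on the left. *)
Definition urep (n : nat) := {lrmorphism U' -> 'M[F]_n}.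

Section Lift.
Variables (n : nat) (f : gen -> 'M[F]_n).

Definition lift_ev of satisfies_Urel f := fun u : U' => ev f (repr u).

Variable fP : satisfies_Urel f.
Local Notation lft := (lift_ev fP).

Lemma lift_pi x : lft (U_pi x) = ev f x.
Proof. exact/(ev_Ueq fP)/U_repr. Qed.

Fact lift_zmod : zmod_morphism lft.
Proof.
do 2![elim/U_piW=> ?].
by rewrite -[- _]U_piM -[_ + _]U_piD !lift_pi /= mul_scalar_mx scaleN1r.
Qed.
HB.instance Definition _ :=
  GRing.isZmodMorphism.Build U' 'M[F]_n lft lift_zmod.

Fact lift_monoid : monoid_morphism lft.
Proof.
split; first exact: lift_pi.
by do 2![elim/U_piW=> ?]; rewrite -[_ * _]U_piM !lift_pi.
Qed.
HB.instance Definition _ :=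
  GRing.isMonoidMorphism.Build U' 'M[F]_n lft lift_monoid.

Fact lift_scale : scalable lft.
Proof.
move=> c; elim/U_piW=> x.
by rewrite -[_ *: _]U_piM !lift_pi /= mul_scalar_mx.
Qed.
HB.instance Definition _ :=
  GRing.isScalable.Build F U' 'M[F]_n *:%R lft lift_scale.

Definition lift : urep n := lft.

Lemma lift_gen g : lift (ugen g) = f g.
Proof. exact: lift_pi. Qed.

End Lift.

Lemma urep_ev n (r : urep n) x : r (U_pi x) = ev (r \o ugen) x.
Proof.
have r1 : r 1 = 1%:M by exact: rmorph1.
elim: x => //= [c|x <- y <-|x <- y <-].
- have -> : U_pi (Cst c) = c *: 1 :> U' by exact/esym/U_mulr1.
  by rewrite linearZ /= r1 scalemx1.
- by rewrite U_piD -[U_add _ _]/(U_pi x + U_pi y) raddfD.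
- by rewrite U_piM -[U_mul _ _]/(U_pi x * U_pi y) rmorphM.
Qed.

Lemma urep_rel n (r : urep n) : satisfies_Urel (r \o ugen).
Proof.
by move=> x y xy; rewrite -!urep_ev; congr (r _); apply/U_piP/Ueq_rel.
Qed.

End Algebra.

Section SerreTensor.
Variables (F : fieldType) (q : F) (q0 : q != 0) (n : nat).
Implicit Types A B C : 'M[F]_n.

Definition mxbracket c A B : 'M[F]_n :=
  c%:M *m (A *m B) + (- c^-1)%:M *m (B *m A).
Definition mxserre A B :=
  mxbracket 1 A (mxbracket q^-1 A (mxbracket q A B)).

Let mxDE A B i j : (A + B) i j = A i j + B i j. Proof. by rewrite mxE. Qed.
Let mxNE A i j : (- A) i j = - A i j. Proof. by rewrite mxE. Qed.
Let mxZE c A i j : (c *: A) i j = c * A i j. Proof. by rewrite mxE. Qed.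
Let mx0E i j : (0 : 'M[F]_n) i j = 0. Proof. by rewrite mxE. Qed.
Let mxlE := (mxDE, mxNE, mxZE, mx0E).

Lemma mxbracketD c A B C :
  mxbracket c A (B + C) = mxbracket c A B + mxbracket c A C.
Proof. by rewrite /mxbracket mulmxDl !mulmxDr addrACA. Qed.

Lemma mxserreD A B C : mxserre A (B + C) = mxserre A B + mxserre A C.
Proof. by rewrite /mxserre !mxbracketD. Qed.

Lemma mxserreE A B : mxserre A B =
  A *m (A *m (A *m B)) - (q ^+ 2 + 1 + q ^- 2) *: (A *m (A *m (B *m A)))
  + (q ^+ 2 + 1 + q ^- 2) *: (A *m (B *m (A *m A))) - B *m (A *m (A *m A)).
Proof.
rewrite /mxserre /mxbracket;
do ! rewrite ?mul_scalar_mx ?mulmxDl ?mulmxDr ?scalerDr -?mulmxA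
  -?scalemxAl -?scalemxAr ?scalerA.
by apply/matrixP=> i j; rewrite !mxlE; field; rewrite ?q0 ?oner_eq0.
Qed.

Lemma mxserre_eq0 A B : mxserre A B = 0 ->
  B *m (A *m (A *m A)) =
  A *m (A *m (A *m B)) - (q ^+ 2 + 1 + q ^- 2) *: (A *m (A *m (B *m A)))
  + (q ^+ 2 + 1 + q ^- 2) *: (A *m (B *m (A *m A))).
Proof. by rewrite mxserreE => /subr0_eq. Qed.

Lemma mxserre_left A B A' : mxserre A A' = 0 ->
  B *m A = q ^- 2 *: (A *m B) -> B *m A' = q ^+ 2 *: (A' *m B) ->
  mxserre (A + B) A' = 0.
Proof.
move=> /mxserre_eq0 sA BA BA'.
have BAx C : B *m (A *m C) = q ^- 2 *: (A *m (B *m C)).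
  by rewrite mulmxA BA -scalemxAl mulmxA.
have BAx' C : B *m (A' *m C) = q ^+ 2 *: (A' *m (B *m C)).
  by rewrite mulmxA BA' -scalemxAl mulmxA.
rewrite mxserreE.
do ! rewrite ?mulmxDl ?mulmxDr ?scalerDr -?mulmxA
  -?scalemxAl -?scalemxAr ?BA ?BA' ?BAx ?BAx' ?scalerA ?sA.
by apply/matrixP=> i j; rewrite !mxlE; field; rewrite ?q0 ?oner_eq0.
Qed.

Lemma mxserre_right A B B' : mxserre B B' = 0 ->
  A *m B = q ^+ 2 *: (B *m A) -> A *m B' = q ^- 2 *: (B' *m A) ->
  mxserre (A + B) B' = 0.
Proof.
move=> /mxserre_eq0 sB AB AB'.
have ABx C : A *m (B *m C) = q ^+ 2 *: (B *m (A *m C)).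
  by rewrite mulmxA AB -scalemxAl mulmxA.
have ABx' C : A *m (B' *m C) = q ^- 2 *: (B' *m (A *m C)).
  by rewrite mulmxA AB' -scalemxAl mulmxA.
rewrite mxserreE.
do ! rewrite ?mulmxDl ?mulmxDr ?scalerDr -?mulmxA
  -?scalemxAl -?scalemxAr ?AB ?AB' ?ABx ?ABx' ?scalerA ?sB.
by apply/matrixP=> i j; rewrite !mxlE; field; rewrite ?q0 ?oner_eq0.
Qed.

End SerreTensor.

Arguments lift {F q n f}.

Section Evaluation.
Variables (F : fieldType) (q : F) (l : nat) (a : F).

(* v_i, with the convention v_i = 0 unless 0 <= i <= l.                       *)
Definition vvec (i : int) : 'cV[F]_(l.+1) := \col_k (k%:Z == i)%:R.

Definition eval_action (g : gen) (i : int) : 'cV[F]_(l.+1) :=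
  match g with
  | GK false | GKV true => q ^ (2 * i - l%:Z) *: vvec i
  | GK true | GKV false => q ^ (l%:Z - 2 * i) *: vvec i
  | GE false => (a * q * qnum q (i + 1)) *: vvec (i + 1)
  | GE true => qnum q (l%:Z - i + 1) *: vvec (i - 1)
  | GEm => qnum q (i + 1) *: vvec (i + 1)
  end.

(* Column j of the matrix of g is the image of v_j.                           *)
Definition eval_gen (g : gen) : 'M[F]_(l.+1) :=
  \matrix_(i, j) eval_action g j%:Z i 0.

Lemma vvec0 i : ~~ (0 <= i <= l%:Z) -> vvec i = 0.
Proof.
move=> il; apply/colP=> k; rewrite !mxE; case: eqP => // ki; case/negP: il.
by rewrite -ki /= lez_nat -ltnS ltn_ord.
Qed.

Lemma eval_gen_basis g (i : int) :
  eval_gen g *m vvec i = eval_action g i.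
Proof.
have [|il] := boolP (0 <= i <= l%:Z).
  case: i => // i /andP[_]; rewrite lez_nat -ltnS => il.
  apply/colP=> k; rewrite !mxE (bigD1 (Ordinal il)) //= big1 ?addr0.
    by rewrite !mxE eqxx mulr1.
  move=> j; rewrite -val_eqE /= => ji.
  by rewrite [vvec _ _ _]mxE eqz_nat (negPf ji) mulr0.
rewrite vvec0 // mulmx0.
case: g => [[]|[]|[]|] /=; try by rewrite vvec0 ?scaler0.
- have [->|i1] := eqVneq i (l%:Z + 1); last by rewrite vvec0 ?scaler0 //; lia.
  by rewrite opprD addrA subrr add0r addNr qnum0 scale0r.
- have [->|i1] := eqVneq i (-1); last by rewrite vvec0 ?scaler0 //; lia.
  by rewrite addNr qnum0 mulr0 scale0r.
- have [->|i1] := eqVneq i (-1); last by rewrite vvec0 ?scaler0 //; lia.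
  by rewrite addNr qnum0 scale0r.
Qed.

Lemma eval_gen_ext n (A B : 'M[F]_(n, l.+1)) :
  (forall i, A *m vvec i = B *m vvec i) -> A = B.
Proof.
move=> AB; apply/matrixP=> k j; have := AB j%:Z.
have -> : vvec j%:Z = delta_mx j 0.
  by apply/colP=> i; rewrite !mxE eqz_nat andbT.
by rewrite -!colE => /colP/(_ k); rewrite !mxE.
Qed.

Lemma eval_gen_rel : q_generic q -> satisfies_Urel q eval_gen.
Proof.
case=> q0 qr x y.
have q2 : q * q - 1 != 0 by rewrite subr_eq0 -expr2 qr.
have qD i j : q ^ (i + j) = q ^ i * q ^ j by rewrite expfzDr.
have q2E i : q ^ (2 * i) = q ^ i * q ^ i.
  by rewrite -qD; congr (_ ^ _); lia.
have qN i : q ^ (- i) = (q ^ i)^-1 by rewrite -invr_expz.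
have qnz i : q ^ i != 0 by rewrite expfz_neq0.
have sc0 c i j : c = 0 -> c *: vvec i = 0 *: vvec j.
  by move=> ->; rewrite !scale0r.
case=> [[]|[]|[]|[]|[]|||||i] /=; last first.
  rewrite -[LHS]/(mxserre q _ _) raddf0 mxserreE //; apply: eval_gen_ext => j.
  case: i; rewrite mul0mx !mulmxDl !mulNmx -!scalemxAl -!mulmxA;
    rewrite !(eval_gen_basis, =^~ scalemxAr) /= !scalerA ?(addrK, subrK);
    rewrite -?scaleNr -!scalerDl -[RHS](scale0r (vvec j)); apply: sc0;
    rewrite /qnum ?(opprD, opprK) ?(qD, q2E, qN) ?expr1z;
    move: (q ^ j) (qnz j) (q ^ l%:Z) (qnz l%:Z) => Q Q0 P P0;
    move: (q - q^-1)^-1 => D; by field; rewrite ?q0 ?Q0 ?P0 ?oner_eq0.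
all: apply: eval_gen_ext => i;
  do ! rewrite ?mulmxDl ?mul_scalar_mx -?mulmxA -?scalemxAr
    -?scalemxAl ?mul1mx ?eval_gen_basis /= ?scalerDr ?scalerA;
  rewrite ?mul0mx ?addrK ?subrK -?scalerDl;
  (apply: sc0 || congr (_ *: _));
  rewrite /qnum ?(opprD, opprK) ?(qD, q2E, qN) ?expr1z;
  move: (q ^ i) (qnz i) (q ^ l%:Z) (qnz l%:Z) => Q Q0 P P0.
all: by field; rewrite ?q0 ?Q0 ?P0 ?q2 ?oner_eq0.
Qed.

End Evaluation.

(* The evaluation module V(l, a), on the basis (vvec l i)_i.                  *)
Definition eval_rep (F : fieldType) (q : F) (hq : q_generic q) (l : nat)
    (a : F) : urep q l.+1 := lift (eval_gen_rel l a hq).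

Section Tensor.
Variables (F : fieldType) (q : F) (m n : nat) (r : urep q m) (s : urep q n).
Local Notation rg g := (r (ugen q g)).
Local Notation sg g := (s (ugen q g)).

(* The image under r ⊗ s of the coproduct of a generator; for e_1^- it is     *)
(* computed as Delta(e_1^- k_1) Delta(k_1^-1).                                *)
Definition tens_gen (g : gen) : 'M[F]_(m * n) :=
  match g with
  | GK _ | GKV _ => rg g *t sg g
  | GE i => rg (GK i) *t sg (GE i) + rg (GE i) *t 1%:M
  | GEm => (rg (GK true) *t s (ugen q GEm * ugen q (GK true))
            + r (ugen q GEm * ugen q (GK true)) *t 1%:M)
           *m (rg (GKV true) *t sg (GKV true))
  end.

Lemma tensmxDl a b c d (A B : 'M[F]_(a, b)) (C : 'M[F]_(c, d)) :
  (A + B) *t C = A *t C + B *t C.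
Proof. by apply/matrixP=> i j; rewrite !mxE mulrDl. Qed.

Lemma tensmxDr a b c d (A : 'M[F]_(a, b)) (B C : 'M[F]_(c, d)) :
  A *t (B + C) = A *t B + A *t C.
Proof. by apply/matrixP=> i j; rewrite !mxE mulrDr. Qed.

Lemma tensmxZl a b c d x (A : 'M[F]_(a, b)) (C : 'M[F]_(c, d)) :
  (x *: A) *t C = x *: (A *t C).
Proof. by apply/matrixP=> i j; rewrite !mxE mulrA. Qed.

Lemma tensmxZr a b c d x (A : 'M[F]_(a, b)) (C : 'M[F]_(c, d)) :
  A *t (x *: C) = x *: (A *t C).
Proof. by apply/matrixP=> i j; rewrite !mxE mulrCA. Qed.

Lemma tensmxNl a b c d (A : 'M[F]_(a, b)) (C : 'M[F]_(c, d)) :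
  (- A) *t C = - (A *t C).
Proof. by rewrite -!scaleN1r tensmxZl. Qed.

Lemma tensmxNr a b c d (A : 'M[F]_(a, b)) (C : 'M[F]_(c, d)) :
  A *t (- C) = - (A *t C).
Proof. by rewrite -!scaleN1r tensmxZr. Qed.

Lemma tensmx11 : (1%:M : 'M[F]_m) *t (1%:M : 'M[F]_n) = 1%:M.
Proof.
apply/matrixP=> i j; rewrite !mxE -natrM mulnb -xpair_eqE.
congr (_ *+ (nat_of_bool _)); apply/eqP/eqP => [|-> //].
by move/(can_inj (@mxtens_unindexK m n)).
Qed.

End Tensor.

Section TensorRel.
Variables (F : fieldType) (q : F) (q0 : q != 0).

Section Rules.
Variables (n : nat) (r : urep q n).
Local Notation K i := (r (ugen q (GK i))).
Local Notation V i := (r (ugen q (GKV i))).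
Local Notation E i := (r (ugen q (GE i))).
Local Notation f := (r (ugen q GEm)).

Let rel x y (xy : Urel q x y) := urep_rel r xy.

Lemma urepKK i : K i *m K (~~ i) = 1%:M. Proof. exact: rel (Urel_kk _ _). Qed.
Lemma urepKV i : K i *m V i = 1%:M. Proof. exact: rel (Urel_kkV _ _). Qed.
Lemma urepVK i : V i *m K i = 1%:M. Proof. exact: rel (Urel_kVk _ _). Qed.

Lemma urepVE i : V i = K (~~ i).
Proof. by rewrite -[LHS]mulmx1 -(urepKK i) mulmxA urepVK mul1mx. Qed.

Let conj i A c : K i *m A *m V i = c%:M *m A -> K i *m A = c *: (A *m K i).
Proof.
move=> KA; rewrite -[LHS]mulmx1 -(urepVK i) mulmxA KA mul_scalar_mx.
by rewrite -scalemxAl.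
Qed.

Lemma urepKE i : K i *m E i = q ^+ 2 *: (E i *m K i).
Proof. exact/conj/(rel (Urel_ke _ _)). Qed.
Lemma urepKE' i : K i *m E (~~ i) = q ^- 2 *: (E (~~ i) *m K i).
Proof. exact/conj/(rel (Urel_ke' _ _)). Qed.
Lemma urepK1m : K true *m f = q ^- 2 *: (f *m K true).
Proof. exact/conj/(rel (Urel_k1em _)). Qed.
Lemma urepK0m : K false *m f = q ^+ 2 *: (f *m K false).
Proof. exact/conj/(rel (Urel_k0em _)). Qed.

Lemma urepEm :
  E true *m f = f *m E true + (q - q^-1)^-1 *: (K true - K false).
Proof.
have := rel (Urel_e1em _); rewrite /= urepVE !mul_scalar_mx invr1 !scaleN1r.
by rewrite scale1r => <-; rewrite addrC subrK.
Qed.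

Lemma urepE0m : E false *m f = f *m E false.
Proof.
have := rel (Urel_e0em _); rewrite /= !mul_scalar_mx invr1 !scaleN1r.
by rewrite scale1r raddf0 => /subr0_eq.
Qed.

Lemma urep_serre i : mxserre q (E i) (E (~~ i)) = 0.
Proof. by have := rel (Urel_serre _ i); rewrite /= raddf0. Qed.

End Rules.

Variables (m n : nat) (r : urep q m) (s : urep q n).
Local Notation D := (tens_gen r s).

Lemma tens_genVE i : D (GKV i) = D (GK (~~ i)).
Proof. by rewrite /= !urepVE. Qed.

Lemma tens_genKK i : D (GK i) *m D (GK (~~ i)) = 1%:M.
Proof. by rewrite /= tensmx_mul !urepKK tensmx11. Qed.

Lemma tens_gen_em :
  D GEm = 1%:M *t s (ugen q GEm) + r (ugen q GEm) *t s (ugen q (GK false)).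
Proof.
rewrite /= !urepVE !rmorphM /= mulmxDl !tensmx_mul -!mulmxA.
by rewrite mul1mx !urepKK !mulmx1.
Qed.

Lemma tens_genKE i j (c : F) : c != 0 ->
  (forall k (t : urep q k), t (ugen q (GK i)) *m t (ugen q (GE j)) =
      c *: (t (ugen q (GE j)) *m t (ugen q (GK i)))) ->
  D (GK i) *m D (GE j) *m D (GKV i) = c%:M *m D (GE j).
Proof.
move=> c0 ct; have KKc k (t : urep q k) :
  t (ugen q (GK i)) *m t (ugen q (GK j)) =
    t (ugen q (GK j)) *m t (ugen q (GK i)).
  have [->//|ij] := eqVneq i j.
  have -> : j = ~~ i by case: (i) (j) ij => [] [].
  by rewrite urepKK -{2}(negbK i) urepKK.
have -> : D (GK i) *m D (GE j) = c *: (D (GE j) *m D (GK i)).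
  rewrite /= mulmxDr mulmxDl !tensmx_mul !ct KKc mulmx1 mul1mx.
  by rewrite tensmxZr tensmxZl scalerDr.
by rewrite -scalemxAl -mulmxA tens_genVE tens_genKK mulmx1 mul_scalar_mx.
Qed.

Lemma tens_genKm i (c : F) : c != 0 ->
  (forall k (t : urep q k), t (ugen q (GK i)) *m t (ugen q GEm) =
      c *: (t (ugen q GEm) *m t (ugen q (GK i)))) ->
  D (GK i) *m D GEm *m D (GKV i) = c%:M *m D GEm.
Proof.
move=> c0 ct; have KKc k (t : urep q k) :
  t (ugen q (GK i)) *m t (ugen q (GK false)) =
    t (ugen q (GK false)) *m t (ugen q (GK i)).
  by case: i {ct} => //; rewrite (urepKK t true) (urepKK t false).
have -> : D (GK i) *m D GEm = c *: (D GEm *m D (GK i)).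
  rewrite tens_gen_em /= mulmxDr mulmxDl !tensmx_mul !ct KKc mulmx1 mul1mx.
  by rewrite tensmxZr tensmxZl scalerDr.
by rewrite -scalemxAl -mulmxA tens_genVE tens_genKK mulmx1 mul_scalar_mx.
Qed.

Lemma tens_gen_serre i : mxserre q (D (GE i)) (D (GE (~~ i))) = 0.
Proof.
have q2 : q ^+ 2 != 0 by rewrite expf_neq0.
rewrite /= mxserreD; set A := r _ *t s _; set B := r _ *t 1%:M.
set A' := r _ *t s _; set B' := r _ *t 1%:M.
have BA : B *m A = q ^- 2 *: (A *m B).
  by rewrite /A /B !tensmx_mul mul1mx mulmx1 urepKE tensmxZl scalerA mulVf ?scale1r.
have AB' : A *m B' = q ^- 2 *: (B' *m A).
  by rewrite /A /B' !tensmx_mul mul1mx mulmx1 urepKE' tensmxZl.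
have BA' : B *m A' = q ^+ 2 *: (A' *m B).
  rewrite /A' /B !tensmx_mul mul1mx mulmx1.
  by have := urepKE' r (~~ i); rewrite negbK => ->; rewrite tensmxZl scalerA divff ?scale1r.
have sA : mxserre q A A' = 0.
  have KK : r (ugen q (GK (~~ i))) *m r (ugen q (GK i)) = 1%:M.
    by rewrite -{2}(negbK i) urepKK.
  have KKx C : r (ugen q (GK (~~ i))) *m (r (ugen q (GK i)) *m C) = C :> 'M_m.
    by rewrite mulmxA KK mul1mx.
  have KKx' C : r (ugen q (GK i)) *m (r (ugen q (GK (~~ i))) *m C) = C :> 'M_m.
    by rewrite mulmxA urepKK mul1mx.
  have -> : mxserre q A A' = (r (ugen q (GK i)) *m r (ugen q (GK i))) *t
      mxserre q (s (ugen q (GE i))) (s (ugen q (GE (~~ i)))).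
    rewrite !mxserreE // /A /A' !tensmx_mul ?(KKx, KKx', urepKK, KK, mulmx1).
    by rewrite !(tensmxDr, tensmxNr, tensmxZr).
  by rewrite urep_serre tensmx0.
have sB : mxserre q B B' = 0.
  have -> : mxserre q B B' =
      mxserre q (r (ugen q (GE i))) (r (ugen q (GE (~~ i)))) *t (1%:M : 'M_n).
    rewrite !mxserreE // /B /B' !tensmx_mul !mulmx1.
    by rewrite !(tensmxDl, tensmxNl, tensmxZl).
  by rewrite urep_serre tens0mx.
rewrite mxserre_left // mxserre_right ?addr0 //.
by rewrite BA scalerA divff ?scale1r.
Qed.

Lemma tens_gen_rel : satisfies_Urel q D.
Proof.
have q2 : q ^+ 2 != 0 by rewrite expf_neq0.
have qV2 : q ^- 2 != 0 by rewrite invr_neq0.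
have cancel (a b c d t1 t2 t3 : 'M[F]_(m * n)) (z : F) :
  a + z *: (t1 - t2) + b + (c + (d + z *: (t2 - t3))) - (a + c + (b + d)) =
  z *: (t1 - t3).
  by apply/matrixP=> i j; rewrite !mxE; ring.
move=> x y; case; cbn [ev bracket].
- exact: tens_genKK.
- by move=> i; rewrite tens_genVE tens_genKK.
- by move=> i; rewrite tens_genVE -{2}(negbK i) tens_genKK.
- by move=> i; apply: tens_genKE => // *; exact: urepKE.
- by move=> i; apply: tens_genKE => // *; exact: urepKE'.
- by apply: tens_genKm => // *; exact: urepK1m.
- by apply: tens_genKm => // *; exact: urepK0m.
- rewrite tens_genVE tens_gen_em /= !mul_scalar_mx scale1r invr1 !scaleN1r.
  rewrite !mulmxDl !mulmxDr !tensmx_mul !mul1mx !mulmx1.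
  rewrite !urepEm urepK1m (urepKE' s false).
  rewrite !(tensmxDl, tensmxDr, tensmxZl, tensmxZr, tensmxNl, tensmxNr).
  exact: cancel.
- rewrite tens_gen_em /= !mul_scalar_mx scale1r invr1 !scaleN1r raddf0.
  rewrite !mulmxDl !mulmxDr !tensmx_mul !mul1mx !mulmx1.
  rewrite !urepE0m urepK0m urepKE !tensmxZl !tensmxZr.
  by rewrite [X in X - _]addrACA subrr.
- by move=> i; rewrite raddf0; exact: tens_gen_serre.
Qed.

End TensorRel.

(* The tensor product of modules, with basis (v *t w) for v, w in the bases.  *)
Definition tens_rep (F : fieldType) (q : F) (hq : q_generic q) (m n : nat)
    (r : urep q m) (s : urep q n) : urep q (m * n) :=
  lift (tens_gen_rel (proj1 hq) r s).

Section Submodules.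
Variables (F : fieldType) (q : F) (N : nat) (r : urep q N).
Implicit Type W : {vspace 'cV[F]_N}.

Definition calU_stable W : Prop :=
  forall u, calU u -> forall w, w \in W -> r u *m w \in W.

Definition calU_irreducible W : Prop :=
  [/\ W != 0%VS, calU_stable W &
      forall W', calU_stable W' -> (W' <= W)%VS -> W' = 0%VS \/ W' = W].

Definition is_Vtilde (n : nat) W : Prop :=
  [/\ calU_irreducible W, \dim W = n.+1 &
      forall i : nat, (i <= n)%N -> exists w, [/\ w \in W, w != 0 &
        r (ugen q (GK true)) *m w = q ^ (n%:Z - 2 * i%:Z) *: w]].

(* The unique irreducible calU-submodule with highest weight q^n.             *)
Definition Vtilde (n : nat) : {vspace 'cV[F]_N} :=
  xget 0%VS [set W | is_Vtilde n W]%classic.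

End Submodules.

(* Linear maps between column spaces are given by their matrices.             *)
Definition calU_linear (F : fieldType) (q : F) (M N : nat)
    (r : urep q M) (s : urep q N) (f : 'M[F]_(N, M)) : Prop :=
  forall u, calU u -> f *m r u = s u *m f.

Definition intertwiner (F : fieldType) (q : F) (M N : nat)
    (r : urep q M) (s : urep q N) (f : 'M[F]_(N, M)) : Prop :=
  f != 0 /\ forall xi : U' q, f *m r xi = s xi *m f.

Section RMatrix.
Variables (F : fieldType) (q : F).

(* The lowest weight vector of weight q^-(l + m - 2 nu) in V(l) ⊗ V(m); it    *)
(* yields x~_n as (lowest_vec l m nu) and x~'_n as (lowest_vec m l nu).       *)
Definition lowest_vec (l m nu : nat) : 'cV[F]_(l.+1 * m.+1) :=
  \sum_(j < nu.+1)
    ((-1) ^+ j * q ^+ (j * (m - j + 1)) *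
     qfact q (l - nu + j) * qfact q (m - j)) *:
    (vvec F l (l - nu + j)%N *t vvec F m (m - j)%N).

Variables (hq : q_generic q) (l m : nat) (a : F).

Definition VW : urep q (l.+1 * m.+1) :=
  tens_rep hq (eval_rep hq l a) (eval_rep hq m 0).
Definition WV : urep q (m.+1 * l.+1) :=
  tens_rep hq (eval_rep hq m 0) (eval_rep hq l a).

(* R_n for n = l + m - 2 nu.                                                  *)
Definition is_Rn (nu : nat) (f : 'M[F]_(m.+1 * l.+1, l.+1 * m.+1)) : Prop :=
  [/\ calU_linear VW WV f,
      forall v, f *m v \in Vtilde WV (l + m - 2 * nu) &
      f *m lowest_vec l m nu = lowest_vec m l nu].

Definition Rn (nu : nat) : 'M[F]_(m.+1 * l.+1, l.+1 * m.+1) :=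
  xget 0 [set f | is_Rn nu f]%classic.

Definition Rmx : 'M[F]_(m.+1 * l.+1, l.+1 * m.+1) :=
  \sum_(nu < (minn l m).+1)
    ((-1) ^+ nu * q ^- (nu * (l + m - nu + 1))) *: Rn nu.

End RMatrix.

(* Main.v *)
Require Import Defs.
From mathcomp Require Import all_boot all_order all_algebra.
From mathcomp Require Import mxtens complex ring zify.
From mathcomp Require Import boolp classical_sets reals.

(** Write [x_nu] and [x'_nu] for the lowest weight vectors of the components of
    V = V(l, a) ⊗ V(m) and V' = V(m) ⊗ V(l, a). Up to the factor [a q], the
    generator [e_0^+] acts on V as [X = e_1^- ⊗ 1] and on V' as
    [X' = k_1^-1 ⊗ e_1^-], because it kills V(m). A direct computation gives
    [X x_(nu+1) = x_nu] and [X' x'_(nu+1) = - q ^ (l + m - 2 nu) x'_nu]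
    ([shift_low], [shift'_low]).

    Uniqueness and the formula for the coefficients follow. A map [f] commuting
    with the copy of U_q(sl_2) sends [x_nu] to a lowest weight vector of the same
    weight, hence to a multiple of [x'_nu] ([lowest_vec_unique]), and if also
    [f X = X' f] then consecutive multiples have the ratio of the coefficients of
    R ([shift_linear]). Such an [f] is determined by its values on the [x_nu]
    ([eq0_on_lowest]), so it is a multiple of R. The last step rests on the
    Casimir element: its values separate the components, and polynomials in it
    provide the projections ([linear_eq0], [linear_component]), which also serve
    to show that the maps R_n exist. The components themselves are identified in
    [Vtilde_cyclic] as the spans of the raised lowest weight vectors.

    It remains to produce one nonzero map with these properties
    ([exchange_exists]); R is then an intertwiner because this map is a multiple
    of it. Let [Y] and [Y'] be the actions of [e_1^-], which commute with [X] and
    [X']. The highest weight vector [v_0 ⊗ v'_0] generates V under [X] and [Y],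
    with the relations [X ^ (l + 1) = 0] and
    [prod_(0 <= i <= m) (Y - q ^ (2 i - m) X) = 0]: the latter product is the
    (m+1)-st power of [1 ⊗ e_1^-] on this vector. Both relations hold for
    [X'], [Y'] and [v'_0 ⊗ v_0]; for the second, take the factors in the opposite
    order ([row_image_top]). So sending one highest weight vector to the other
    defines a map with [S X = X' S] and [S Y = Y' S], and only the commutation
    with [E = e_1^+] is left. By the relation of [E] with [Y], the map
    [S E - E' S] intertwines [Y] and [Y']. For [X], the matrix
    [E X - q^-2 X E] is an affine function of [twist = k_1^-1 ⊗ 1], whose
    relations with [X] and [Y] have exact analogues on the other side; as the
    generating vector is killed by [E] and an eigenvector of [twist], first
    [S twist - twist' S] and then [S E - E' S] vanish. *)

Set Implicit Arguments.
Unset Strict Implicit.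
Unset Printing Implicit Defensive.
Import Order.TTheory GRing.Theory Num.Theory.
Local Open Scope ring_scope.

(** * Powers of q *)

Section QPowers.
Variables (F : fieldType) (q : F) (hq : q_generic q).

Lemma q_neq0 : q != 0. Proof. by case: hq. Qed.

Lemma qexpz_neq0 (s : int) : q ^ s != 0.
Proof. exact/expfz_neq0/q_neq0. Qed.

Lemma qexpzD (s t : int) : q ^ (s + t) = q ^ s * q ^ t.
Proof. exact/expfzDr/q_neq0. Qed.

Lemma qexpzN (s : int) : q ^ (- s) = (q ^ s)^-1.
Proof. by rewrite invr_expz. Qed.

Lemma qexpz_eq1 (s : int) : (q ^ s == 1) = (s == 0).
Proof.
have pos (n : nat) : (0 < n)%N -> q ^ n%:Z != 1 by case: hq => _; apply.
case: s => [[|n]|n]; rewrite ?expr0z ?eqxx ?(negPf (pos n.+1 _)) //.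
by rewrite NegzE qexpzN invr_eq1 (negPf (pos _ _)).
Qed.

Lemma qexpz_inj : injective (fun s : int => q ^ s).
Proof.
move=> s t /= st; apply/eqP; rewrite -subr_eq0 -qexpz_eq1 qexpzD qexpzN st.
by rewrite divff ?qexpz_neq0.
Qed.

Lemma qqV_neq0 : q - q^-1 != 0.
Proof.
rewrite subr_eq0; apply/eqP => /(congr1 ( *%R q)).
rewrite divff ?q_neq0 // => /eqP; rewrite -expr2.
by apply/negP; case: hq => _; apply.
Qed.

Lemma qnum_neq0 (s : int) : s != 0 -> qnum q s != 0.
Proof.
move=> s0; rewrite mulf_neq0 ?invr_eq0 ?qqV_neq0 // subr_eq0.
by apply/eqP => /qexpz_inj; lia.
Qed.

Lemma qfact_neq0 n : qfact q n != 0.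
Proof.
rewrite /qfact prodf_seq_neq0; apply/allP => i.
by rewrite mem_index_iota => i0; apply: qnum_neq0; lia.
Qed.

Lemma qfactS n : qfact q n.+1 = qfact q n * qnum q n.+1%:Z.
Proof. by rewrite /qfact big_nat_recr. Qed.

(** The value of the Casimir element on the irreducible module whose highest
    weight is [s]. *)
Definition cas_val (s : int) : F :=
  (q ^ (s + 1) + q ^ (- s - 1)) / (q - q^-1) ^+ 2.

Lemma cas_valC s : cas_val (- s - 2) = cas_val s.
Proof. by rewrite /cas_val addrC; congr ((q ^ _ + q ^ _) / _); lia. Qed.

(** With [A = q ^ (s + 1)] and [B = q ^ (t + 1)], the difference of
    [A + A^-1] and [B + B^-1] is [A^-1 * (A - B) * (A - B^-1)]. *)
Lemma cas_val_neq s t : s != t -> s != - t - 2 -> cas_val s != cas_val t.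
Proof.
move=> st st'; rewrite -subr_eq0 -mulrBl mulf_neq0 ?invr_eq0 //; last first.
  by rewrite expf_neq0 ?qqV_neq0.
have -> : q ^ (s + 1) + q ^ (- s - 1) - (q ^ (t + 1) + q ^ (- t - 1)) =
    q ^ (- s - 1) * (q ^ (s + 1) - q ^ (t + 1)) * (q ^ (s + 1) - q ^ (- t - 1)).
  have q0 := q_neq0; rewrite !(qexpzD, qexpzN).
  move: (q ^ s) (qexpz_neq0 s) (q ^ t) (qexpz_neq0 t) => S S0 T T0.
  by field; rewrite S0 T0 q0 ?oner_eq0.
rewrite !mulf_neq0 ?qexpz_neq0 // subr_eq0; apply/eqP => /qexpz_inj; lia.
Qed.

End QPowers.

(** * The subalgebra generated by e_1 and k_1, and its Casimir element *)

Section Subalgebra.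
Variables (F : fieldType) (q : F).

Section Linear.
Variables (M N : nat) (r : urep q M) (s : urep q N) (f : 'M[F]_(N, M)).

Lemma commK_inv i : f *m r (ugen q (GK i)) = s (ugen q (GK i)) *m f ->
  f *m r (ugen q (GK (~~ i))) = s (ugen q (GK (~~ i))) *m f.
Proof.
move=> fK; rewrite -[LHS]mul1mx -(urepKK s (~~ i)) negbK -mulmxA.
by rewrite (mulmxA _ f) -fK -!mulmxA urepKK mulmx1.
Qed.

Lemma calU_linearP :
  f *m r (ugen q (GK true)) = s (ugen q (GK true)) *m f ->
  f *m r (ugen q (GE true)) = s (ugen q (GE true)) *m f ->
  f *m r (ugen q GEm) = s (ugen q GEm) *m f -> calU_linear r s f.
Proof.
move=> fK fE fF u; elim=> {u} //.
- by rewrite !urepVE; exact: commK_inv fK.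
- by rewrite !rmorph1 mulmx1 mul1mx.
- by move=> c u _ fu; rewrite [r _]linearZ [s _]linearZ /= -scalemxAr fu scalemxAl.
- by move=> u v _ fu _ fv; rewrite [r _]raddfD [s _]raddfD /= mulmxDr fu fv mulmxDl.
- by move=> u v _ fu _ fv; rewrite !rmorphM /= mulmxA fu -mulmxA fv mulmxA.
Qed.

(** Since [k_0] is the inverse of [k_1], the subalgebra generated by [e_1^+],
    [e_1^-] and [k_1] misses only the generator [e_0^+]. *)
Lemma intertwinerP : calU_linear r s f -> f != 0 ->
  f *m r (ugen q (GE false)) = s (ugen q (GE false)) *m f ->
  intertwiner r s f.
Proof.
move=> fU f0 fE0; split=> //.
have fK i : f *m r (ugen q (GK i)) = s (ugen q (GK i)) *m f.
  by case: i; last apply: (@commK_inv true); exact/fU/calU_k1.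
elim/U_piW => x; rewrite !urep_ev; elim: x => [g|c|x fx y fy|x fx y fy] /=.
- case: g => [i|i|[]|] //; try exact: fK.
  + by rewrite !urepVE; exact: fK.
  + exact/fU/calU_e1p.
  + exact/fU/calU_e1m.
- by rewrite scalar_mxC.
- by rewrite mulmxDr fx fy mulmxDl.
- by rewrite mulmxA fx -mulmxA fy mulmxA.
Qed.

End Linear.

Lemma calU_stableP N (r : urep q N) (W : {vspace 'cV[F]_N}) :
  (forall w, w \in W -> [/\ r (ugen q (GK true)) *m w \in W,
     r (ugen q (GK false)) *m w \in W, r (ugen q (GE true)) *m w \in W &
     r (ugen q GEm) *m w \in W]) -> calU_stable r W.
Proof.
move=> stW u; elim=> {u} [||||w Ww|c u _ IH w Ww|u v _ IHu _ IHv w Ww|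
  u v _ IHu _ IHv w Ww].
- by move=> w /stW[].
- by move=> w /stW[]; rewrite urepVE.
- by move=> w /stW[].
- by move=> w /stW[].
- by rewrite rmorph1 mul1mx.
- by rewrite [r _]linearZ /= -scalemxAl memvZ ?IH.
- by rewrite [r _]raddfD /= mulmxDl memvD ?IHu ?IHv.
- by rewrite rmorphM /= -mulmxA IHu ?IHv.
Qed.

(** The quantum Casimir element of the subalgebra, written here with the
    lowering operator on the left. *)
Definition cas : U' q :=
  ugen q GEm * ugen q (GE true) + (q - q^-1) ^- 2 *:
    (q *: ugen q (GK true) + q^-1 *: ugen q (GKV true)).

Lemma calU_cas : calU cas.
Proof.
by apply: calU_add; first apply: calU_mul; try apply: calU_scale;
  try apply: calU_add; try apply: calU_scale; constructor.
Qed.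

Lemma calU_cas_poly (p : {poly F}) : calU (horner_alg cas p).
Proof.
elim/poly_ind: p => [|p c IH]; first by rewrite rmorph0 -(scale0r 1); do !constructor.
rewrite rmorphD rmorphM /= horner_algX horner_algC.
by do ![exact: calU_cas | constructor | assumption].
Qed.

End Subalgebra.


(** * Weights in finite-dimensional modules *)

Section Weights.
(* [KV] is [k_0], which acts as the inverse of [k_1]. *)
Variables (F : fieldType) (q : F) (hq : q_generic q) (N : nat) (r : urep q N).
Local Notation K := (r (ugen q (GK true))).
Local Notation KV := (r (ugen q (GK false))).
Local Notation E := (r (ugen q (GE true))).
Local Notation L := (r (ugen q GEm)).
Local Notation C := (r (cas q)).
Implicit Types (s : int) (v w x y : 'cV[F]_N).

Definition weight s v := K *m v = q ^ s *: v.

Lemma weightZ s c v : weight s v -> weight s (c *: v).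
Proof. by rewrite /weight -scalemxAr => ->; rewrite !scalerA mulrC. Qed.

Lemma weight_sum s (I : Type) (t : seq I) (P : pred I) (v : I -> 'cV_N) :
  (forall i, P i -> weight s (v i)) -> weight s (\sum_(i <- t | P i) v i).
Proof.
by move=> wv; rewrite /weight mulmx_sumr scaler_sumr; apply: eq_bigr.
Qed.

Lemma weightV s v : weight s v -> KV *m v = q ^ (- s) *: v.
Proof.
move=> wv; have : KV *m (K *m v) = v.
  by rewrite mulmxA -[K]/(r (ugen q (GK (~~ false)))) urepKK mul1mx.
rewrite wv -scalemxAr => {2}<-.
by rewrite scalerA qexpzN mulVf ?qexpz_neq0 // scale1r.
Qed.

Lemma weight_raise s v : weight s v -> weight (s + 2) (E *m v).
Proof.
rewrite /weight mulmxA urepKE -scalemxAl -mulmxA => ->.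
by rewrite -scalemxAr scalerA (qexpzD hq) mulrC.
Qed.

Lemma weight_lower s v : weight s v -> weight (s - 2) (L *m v).
Proof.
rewrite /weight mulmxA urepK1m -scalemxAl -mulmxA => ->.
by rewrite -scalemxAr scalerA (qexpzD hq) mulrC.
Qed.

Lemma casE : C = L *m E + (q - q^-1) ^- 2 *: (q *: K + q^-1 *: KV).
Proof.
rewrite /cas raddfD /= rmorphM [r (_ *: _)]linearZ raddfD /=.
by rewrite ![r (_ *: _)]linearZ /= urepVE.
Qed.

Lemma casE' : C = E *m L + (q - q^-1) ^- 2 *: (q^-1 *: K + q *: KV).
Proof.
rewrite casE urepEm -!addrA; congr (_ + _).
have q0 := q_neq0 hq; have d0 := qqV_neq0 hq.
have qq0 : q * q - 1 != 0.
  have -> : q * q - 1 = q * (q - q^-1) by field.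
  by rewrite mulf_neq0.
apply/matrixP => i j; rewrite !mxE; field.
by rewrite qq0 q0.
Qed.

Lemma cas_raise : C *m E = E *m C.
Proof.
rewrite {1}casE' casE mulmxDl mulmxDr mulmxA; congr (_ + _).
have KE : K *m E = q ^+ 2 *: (E *m K) := urepKE r true.
have VE : KV *m E = q ^- 2 *: (E *m KV) := urepKE' r false.
rewrite -scalemxAl -scalemxAr !(mulmxDl, mulmxDr) -!scalemxAl -!scalemxAr KE VE.
have q0 := q_neq0 hq.
by rewrite !scalerA; congr (_ *: (_ *: _ + _ *: _)); field.
Qed.

Lemma cas_lower : C *m L = L *m C.
Proof.
rewrite {1}casE casE' mulmxDl mulmxDr mulmxA; congr (_ + _).
rewrite -scalemxAl -scalemxAr !(mulmxDl, mulmxDr) -!scalemxAl -!scalemxAr.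
rewrite urepK1m urepK0m.
have q0 := q_neq0 hq.
by rewrite !scalerA; congr (_ *: (_ *: _ + _ *: _)); field.
Qed.

Lemma cas_K : C *m K = K *m C.
Proof.
have KE : K *m E = q ^+ 2 *: (E *m K) := urepKE r true.
have VK : KV *m K = K *m KV by rewrite (urepKK r false) (urepKK r true).
rewrite casE mulmxDl mulmxDr; congr (_ + _); last first.
  rewrite -scalemxAl -scalemxAr !(mulmxDl, mulmxDr) -!scalemxAl -!scalemxAr.
  by rewrite VK.
rewrite mulmxA urepK1m -scalemxAl -!mulmxA KE -scalemxAr scalerA mulVf ?scale1r //.
by rewrite expf_neq0 ?(q_neq0 hq).
Qed.

(** On a vector of weight [s] the Casimir differs from both products of the
    raising and the lowering operator by a scalar; everything below about
    finite-dimensional modules comes from these two formulas. *)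
Lemma lower_raise s v : weight s v -> L *m (E *m v) = C *m v - cas_val q s *: v.
Proof.
move=> wv; rewrite mulmxA casE mulmxDl -scalemxAl mulmxDl -!scalemxAl.
rewrite wv (weightV wv) !scalerA -scalerDl scalerA -addrA -scalerBl.
rewrite [X in X *: _](_ : _ = 0) ?scale0r ?addr0 //.
rewrite /cas_val !(qexpzD hq) !qexpzN expr1z mulrC.
by have := q_neq0 hq; have := qexpz_neq0 hq s => *; ring.
Qed.

Lemma raise_lower s v :
  weight s v -> E *m (L *m v) = C *m v - cas_val q (- s) *: v.
Proof.
move=> wv; rewrite mulmxA casE' mulmxDl -scalemxAl mulmxDl -!scalemxAl.
rewrite wv (weightV wv) !scalerA -scalerDl scalerA -addrA -scalerBl.
rewrite [X in X *: _](_ : _ = 0) ?scale0r ?addr0 //.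
rewrite /cas_val !(qexpzD hq) !qexpzN !invrK expr1z mulrC.
by have := q_neq0 hq; have := qexpz_neq0 hq s => *; ring.
Qed.

Lemma cas_lowest s v : weight s v -> L *m v = 0 -> C *m v = cas_val q (- s) *: v.
Proof.
by move=> wv Lv; apply/subr0_eq; rewrite -(raise_lower wv) Lv mulmx0.
Qed.

Section Polynomial.
Variable p : {poly F}.
Local Notation CP := (r (horner_alg (cas q) p)).

Lemma comm_cas_poly A : C *m A = A *m C -> CP *m A = A *m CP.
Proof.
move=> CA; elim/poly_ind: p => [|p' c IH].
  by rewrite !rmorph0 mul0mx mulmx0.
rewrite rmorphD rmorphM /= horner_algX horner_algC raddfD /= rmorphM.
rewrite [r (_ *: _)]linearZ rmorph1 /= mulmxDl mulmxDr.
by rewrite -!mulmxA CA !mulmxA IH -scalemxAl -scalemxAr mul1mx mulmx1.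
Qed.

Lemma cas_poly_eigen c v : C *m v = c *: v -> CP *m v = p.[c] *: v.
Proof.
move=> Cv; elim/poly_ind: p => [|p' d IH].
  by rewrite !rmorph0 mul0mx horner0 scale0r.
rewrite rmorphD rmorphM /= horner_algX horner_algC raddfD /= rmorphM.
rewrite [r (_ *: _)]linearZ rmorph1 /= mulmxDl -mulmxA Cv -scalemxAr IH.
by rewrite -scalemxAl mul1mx scalerA -scalerDl !hornerE mulrC.
Qed.

End Polynomial.

Lemma cas_polyXsubC c (p : {poly F}) v :
  r (horner_alg (cas q) (('X - c%:P) * p)) *m v =
  r (horner_alg (cas q) p) *m (C *m v - c *: v).
Proof.
rewrite mulrC rmorphM rmorphB /= horner_algX horner_algC rmorphM -mulmxA.
rewrite raddfB /= [r (_ *: _)]linearZ rmorph1 /= mulmxBl.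
by rewrite -scalemxAl mul1mx.
Qed.

(** [B] bounds the weights of the module, which all have the parity of [B]. *)
Variable B : nat.

Definition weighted := forall v, exists w : 'I_B.+1 -> 'cV[F]_N,
  v = \sum_i w i /\ forall i : 'I_B.+1, weight (B%:Z - 2 * i%:Z) (w i).

Hypothesis wtd : weighted.

Lemma weighted_ind (P : 'cV[F]_N -> Prop) : P 0 ->
  (forall v w, P v -> P w -> P (v + w)) ->
  (forall (i : nat) v, (i <= B)%N -> weight (B%:Z - 2 * i%:Z) v -> P v) ->
  forall v, P v.
Proof.
move=> P0 PD Pw v; have [w [-> ww]] := wtd v.
by elim/big_ind: _ => // i _; apply: Pw (ww i); rewrite -ltnS.
Qed.

(** A vector whose weight is not one of the allowed ones is killed by the
    product of the [K - q ^ t] over the allowed [t], which acts on it by a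
    nonzero scalar. *)
Lemma weight_out s v : weight s v ->
  (forall i : nat, (i <= B)%N -> s != B%:Z - 2 * i%:Z) -> v = 0.
Proof.
move=> wv sB; pose ts := [seq B%:Z - 2 * i%:Z | i : nat <- iota 0 B.+1].
pose P := foldr (fun t M => (K - (q ^ t)%:M) *m M) 1%:M.
have PE t u : weight t u -> forall tt, P tt *m u =
    (\prod_(t' <- tt) (q ^ t - q ^ t')) *: u.
  move=> wu; elim=> [|t' tt IH] /=; first by rewrite big_nil mul1mx scale1r.
  rewrite big_cons -mulmxA IH -scalemxAr mulmxBl wu mul_scalar_mx -scalerBl.
  by rewrite scalerA mulrC.
have P0 (u : 'cV_N) : P ts *m u = 0.
  move: u; apply: weighted_ind => [|v' w IHv IHw|i u iB wu]; first exact: mulmx0.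
    by rewrite mulmxDr IHv IHw addr0.
  rewrite (PE _ _ wu) big_map (big_rem i) ?mem_iota ?add0n ?ltnS //.
  by rewrite /= subrr mul0r scale0r.
move: (P0 v); rewrite (PE _ _ wv) => /eqP; rewrite scaler_eq0 => /orP[|/eqP//].
rewrite big_map prodf_seq_eq0 => /hasP; case=> i.
rewrite mem_iota /= add0n ltnS => iB.
by rewrite subr_eq0 => /eqP/(qexpz_inj hq) st; case/eqP: (sB i iB).
Qed.

Lemma weight_big s v : weight s v -> B%:Z < `|s| -> v = 0.
Proof. by move=> wv sB; apply: weight_out wv _ => i iB; lia. Qed.

(** Raising [v] repeatedly leaves the range of weights, and by [lower_raise] each
    lowering back only multiplies by a nonzero scalar. *)
Lemma cas_above (n s : int) v : -1 <= n -> n < s -> C *m v = cas_val q n *: v ->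
  weight s v -> v = 0.
Proof.
move=> n1; have [k] : exists k : nat, B%:Z < s + 2 * k%:Z.
  by exists (B + `|s|).+1; lia.
elim: k s v => [|k IH] s v sB ns Cv wv; first by apply: weight_big wv _; lia.
have Ev0 : E *m v = 0.
  apply: IH (weight_raise wv); [lia | lia |].
  by rewrite mulmxA cas_raise -mulmxA Cv -scalemxAr.
have := lower_raise wv; rewrite Ev0 mulmx0 Cv -scalerBl => /esym/eqP.
rewrite scaler_eq0 subr_eq0 (negPf (cas_val_neq _ _ _)) //; [by move/eqP|lia|lia].
Qed.

Lemma cas_below (n s : int) v : -1 <= n -> s < - n ->
  C *m v = cas_val q n *: v -> weight s v -> v = 0.
Proof.
move=> n1; have [k] : exists k : nat, B%:Z < 2 * k%:Z - s.
  by exists (B + `|s|).+1; lia.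
elim: k s v => [|k IH] s v sB ns Cv wv; first by apply: weight_big wv _; lia.
have Lv0 : L *m v = 0.
  apply: IH (weight_lower wv); [lia | lia |].
  by rewrite mulmxA cas_lower -mulmxA Cv -scalemxAr.
have := raise_lower wv; rewrite Lv0 mulmx0 Cv -scalerBl => /esym/eqP.
rewrite scaler_eq0 subr_eq0 (negPf (cas_val_neq _ _ _)) //; [by move/eqP|lia|lia].
Qed.

Lemma lower_inj s v : 0 < s -> weight s v -> L *m v = 0 -> v = 0.
Proof.
move=> s0 wv Lv; apply: (@cas_above (s - 2) s v _ _ _ wv); [lia | lia |].
rewrite (cas_lowest wv Lv) -(cas_valC q (s - 2)).
by congr (cas_val q _ *: _); lia.
Qed.

Lemma raise_inj s v : s < 0 -> weight s v -> E *m v = 0 -> v = 0.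
Proof.
move=> s0 wv Ev; apply: (@cas_below (- s - 2) s v _ _ _ wv); [lia | lia |].
apply/subr0_eq; by rewrite cas_valC -(lower_raise wv) Ev mulmx0.
Qed.

(** [cas_poly i.+1] kills the vectors of weight [B - 2 i], by induction from the
    top of the weight range: its last factor maps them to the lowered image of
    vectors of weight [B - 2 (i - 1)]. Going up from the bottom of the range, it
    also kills the vectors of the opposite weight. Both directions are needed for
    the roots of [cas_poly B./2.+1], which kills everything, to be distinct. *)
Definition cas_poly (i : nat) : {poly F} :=
  \prod_(j < i) ('X - (cas_val q (B%:Z - 2 * j%:Z))%:P).

Lemma cas_polyS i : cas_poly i.+1 =
  ('X - (cas_val q (B%:Z - 2 * i%:Z))%:P) * cas_poly i.
Proof. by rewrite /cas_poly big_ord_recr [LHS]mulrC. Qed.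

Lemma cas_poly_dvd i j v : (i <= j)%N ->
  r (horner_alg (cas q) (cas_poly i)) *m v = 0 ->
  r (horner_alg (cas q) (cas_poly j)) *m v = 0.
Proof.
move=> /subnKC <- pi; elim: (j - i)%N => [|k IH]; first by rewrite addn0.
rewrite addnS cas_polyS !rmorphM /= -mulmxA IH.
exact: mulmx0.
Qed.

Lemma cas_poly_raise i v : weight (B%:Z - 2 * i%:Z) v ->
  r (horner_alg (cas q) (cas_poly i.+1)) *m v = 0.
Proof.
elim: i v => [|i IH] v wv; rewrite cas_polyS cas_polyXsubC -(lower_raise wv).
  by rewrite (weight_big (weight_raise wv)) ?mulmx0 //; lia.
rewrite mulmxA comm_cas_poly ?cas_lower // -mulmxA IH ?mulmx0 //.
by have := weight_raise wv; congr weight; lia.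
Qed.

Lemma cas_poly_lower i v : weight (- (B%:Z - 2 * i%:Z)) v ->
  r (horner_alg (cas q) (cas_poly i.+1)) *m v = 0.
Proof.
elim: i v => [|i IH] v wv; rewrite cas_polyS cas_polyXsubC;
  have := raise_lower wv; rewrite opprK => <-.
  by rewrite (weight_big (weight_lower wv)) ?mulmx0 //; lia.
rewrite mulmxA comm_cas_poly ?cas_raise // -mulmxA IH ?mulmx0 //.
by have := weight_lower wv; congr weight; lia.
Qed.

Lemma cas_poly_eq0 v : r (horner_alg (cas q) (cas_poly B./2.+1)) *m v = 0.
Proof.
move: v; apply: weighted_ind => [|v w IHv IHw|i v iB wv]; first exact: mulmx0.
  by rewrite mulmxDr IHv IHw addr0.
have [i2|i2] := leqP i B./2; first exact: cas_poly_dvd (cas_poly_raise wv).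
apply: (@cas_poly_dvd (B - i).+1); first by lia.
by apply: cas_poly_lower; move: wv; congr weight; lia.
Qed.

(** Up to a nonzero scalar, the projection onto the eigenspace of the Casimir
    for the highest weight [B - 2 nu]. *)
Definition isotypic (nu : nat) : {poly F} :=
  \prod_(j < B./2.+1 | j != nu :> nat) ('X - (cas_val q (B%:Z - 2 * j%:Z))%:P).

Lemma isotypic_eigen nu v : (nu <= B./2)%N ->
  let w := r (horner_alg (cas q) (isotypic nu)) *m v in
  C *m w = cas_val q (B%:Z - 2 * nu%:Z) *: w.
Proof.
move=> nuB w; apply/subr0_eq.
rewrite /w mulmxA -comm_cas_poly // scalemxAr -mulmxA -mulmxBr -cas_polyXsubC.
have := cas_poly_eq0 v.
by rewrite /cas_poly (bigD1 (Ordinal (nuB : (nu < B./2.+1)%N))).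
Qed.

Lemma isotypic_neq0 nu : (nu <= B./2)%N ->
  (isotypic nu).[cas_val q (B%:Z - 2 * nu%:Z)] != 0.
Proof.
move=> nuB; rewrite horner_prod; apply/prodf_neq0 => j jnu.
rewrite hornerXsubC subr_eq0; have := ltn_ord j; have/eqP := jnu => *.
by apply: cas_val_neq; [exact: hq | lia | lia].
Qed.

End Weights.


(** * Irreducible submodules generated by lowest weight vectors *)

Lemma mulmx_span (F : fieldType) m n (A : 'M[F]_(m, n)) (X : seq 'cV[F]_n)
    (U : {vspace 'cV[F]_m}) :
  (forall v, v \in X -> A *m v \in U) -> forall w, w \in <<X>>%VS -> A *m w \in U.
Proof.
move=> AX w wX; have : (<<X>> <= linfun (mulmx A) @^-1: U)%VS.
  by apply/span_subvP => v vX; rewrite -memv_preim lfunE /= AX.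
by move=> /subvP/(_ w wX); rewrite -memv_preim lfunE.
Qed.

Section Cyclic.
Variables (F : fieldType) (q : F) (hq : q_generic q) (N : nat) (r : urep q N).
Variables (B : nat) (wtd : weighted r B).
Local Notation K := (r (ugen q (GK true))).
Local Notation KV := (r (ugen q (GK false))).
Local Notation E := (r (ugen q (GE true))).
Local Notation L := (r (ugen q GEm)).
Local Notation C := (r (cas q)).
Implicit Types (s : int) (v w x y : 'cV[F]_N) (W : {vspace 'cV[F]_N}).

Lemma urepXS a (j : nat) : r (a ^+ j.+1) = r a *m r (a ^+ j).
Proof. by rewrite exprS rmorphM. Qed.

Definition lowest (n : int) x := L *m x = 0 /\ weight r (- n) x.

Lemma cas_low n x : lowest n x -> C *m x = cas_val q n *: x.
Proof. by case=> Lx wx; rewrite (cas_lowest hq wx Lx) opprK. Qed.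

(** The weights are bounded below, so some power of the lowering operator kills
    [v]; the exponent before the least such one is the right one. *)
Lemma descend s v : weight r s v -> v != 0 -> exists j : nat,
  r (ugen q GEm ^+ j) *m v != 0 /\
  lowest (2 * j%:Z - s) (r (ugen q GEm ^+ j) *m v).
Proof.
move=> wv v0; have wL (j : nat) :
    weight r (s - 2 * j%:Z) (r (ugen q GEm ^+ j) *m v).
  elim: j => [|j IH]; first by rewrite expr0 rmorph1 mul1mx mulr0 subr0.
  rewrite urepXS -mulmxA.
  by have := weight_lower hq IH; congr weight; lia.
have exL : exists j : nat, r (ugen q GEm ^+ j.+1) *m v == 0.
  exists (B + `|s|)%N; apply/eqP/(weight_big hq wtd (wL _)); lia.
case: (ex_minnP exL) => j /eqP Lj0 minj; exists j; split; last first.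
  split; first by rewrite mulmxA -urepXS.
  by have := wL j; congr weight; lia.
case: j minj {Lj0} => [|j] minj; first by rewrite expr0 rmorph1 mul1mx.
by apply/negP => /minj; rewrite ltnn.
Qed.

Definition cyclic (n : nat) x : {vspace 'cV[F]_N} :=
  <<[seq r (ugen q (GE true) ^+ k) *m x | k <- iota 0 n.+1]>>%VS.

Section Lowest.
Variables (n : nat) (x : 'cV[F]_N).
Hypothesis lx : lowest n%:Z x.
Local Notation e k := (r (ugen q (GE true) ^+ k) *m x).

Lemma raise_powS k : E *m e k = e k.+1.
Proof. by rewrite urepXS mulmxA. Qed.

Lemma raise_pow0 : e 0%N = x. Proof. by rewrite expr0 rmorph1 mul1mx. Qed.

Lemma weight_raise_pow k : weight r (2 * k%:Z - n%:Z) (e k).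
Proof.
elim: k => [|k IH]; first by rewrite raise_pow0 mulr0 sub0r; case: lx.
by rewrite -raise_powS; have := weight_raise hq IH; congr weight; lia.
Qed.

Lemma cas_raise_pow k : C *m e k = cas_val q n%:Z *: e k.
Proof.
elim: k => [|k IH]; first by rewrite raise_pow0 (cas_low lx).
by rewrite -raise_powS mulmxA cas_raise // -mulmxA IH -scalemxAr.
Qed.

Lemma lower_raise_pow k :
  L *m e k.+1 = (cas_val q n%:Z - cas_val q (2 * k%:Z - n%:Z)) *: e k.
Proof.
by rewrite -raise_powS (lower_raise hq (weight_raise_pow k)) cas_raise_pow scalerBl.
Qed.

Lemma lower_raise_pow_neq0 (k : nat) : (k < n)%N ->
  cas_val q n%:Z - cas_val q (2 * k%:Z - n%:Z) != 0.
Proof. by move=> kn; rewrite subr_eq0; apply: cas_val_neq => //; lia. Qed.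

Lemma raise_pow_top : e n.+1 = 0.
Proof.
by apply: (cas_above hq wtd _ _ (cas_raise_pow n.+1) (weight_raise_pow n.+1)); lia.
Qed.

Lemma mem_raise_pow k : (k <= n)%N -> e k \in cyclic n x.
Proof.
by move=> kn; apply/memv_span/mapP; exists k => //; rewrite mem_iota add0n ltnS.
Qed.

Lemma mem_cyclic : x \in cyclic n x.
Proof. by rewrite -{1}raise_pow0 mem_raise_pow. Qed.

Lemma cyclic_stable : calU_stable r (cyclic n x).
Proof.
apply: calU_stableP => w wW.
split; move: w wW; apply: mulmx_span => v /mapP[k]; rewrite mem_iota add0n ltnS /=;
  move=> kn ->.
- by rewrite (weight_raise_pow k) memvZ ?mem_raise_pow.
- by rewrite (weightV hq (weight_raise_pow k)) memvZ ?mem_raise_pow.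
- rewrite raise_powS; move: kn; rewrite leq_eqVlt => /predU1P[->|];
    last exact: mem_raise_pow.
  by rewrite raise_pow_top mem0v.
- case: k kn => [_|k kn].
    by rewrite raise_pow0; case: lx => -> _; rewrite mem0v.
  by rewrite lower_raise_pow memvZ ?mem_raise_pow // ltnW.
Qed.

Lemma cyclic_min W : calU_stable r W -> x \in W -> (cyclic n x <= W)%VS.
Proof.
move=> stW xW; apply/span_subvP => v /mapP[k _ ->]; elim: k => [|k IH].
  by rewrite raise_pow0.
by rewrite -raise_powS; apply: stW IH; constructor.
Qed.

Lemma cyclic_cas w : w \in cyclic n x -> C *m w = cas_val q n%:Z *: w.
Proof.
move=> wW; apply/subr0_eq/eqP; rewrite -mul_scalar_mx -mulmxBl -memv0.
move: w wW; apply: mulmx_span => v /mapP[k _ ->].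
by rewrite mulmxBl mul_scalar_mx cas_raise_pow subrr mem0v.
Qed.

Hypothesis x0 : x != 0.

Lemma lower_pow_raise_pow k j : (k <= n)%N ->
  (r (ugen q GEm ^+ j) *m e k == 0) = (k < j)%N.
Proof.
elim: j k => [|j IH] k kn.
  rewrite expr0 rmorph1 mul1mx; apply/negbTE; elim: k kn => [|k IH] kn.
    by rewrite raise_pow0.
  apply/eqP => ek0; have /eqP := lower_raise_pow k.
  rewrite ek0 mulmx0 eq_sym scaler_eq0 (negPf (lower_raise_pow_neq0 kn)).
  by rewrite (negPf (IH (ltnW kn))).
rewrite exprSr rmorphM /= -mulmxA; case: k kn => [_|k kn].
  by rewrite raise_pow0; case: lx => -> _; rewrite mulmx0 eqxx.
rewrite lower_raise_pow -scalemxAr scaler_eq0.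
by rewrite (negPf (lower_raise_pow_neq0 kn)) IH // ltnW.
Qed.

Lemma raise_pow_neq0 k : (k <= n)%N -> e k != 0.
Proof.
move=> kn; have := lower_pow_raise_pow 0 kn.
by rewrite expr0 rmorph1 mul1mx => ->.
Qed.

(** The [k]-th power of the lowering operator kills the first [k] vectors of
    the basis, and not the next one. *)
Lemma dim_cyclic : \dim (cyclic n x) = n.+1.
Proof.
suff /eqnP -> : free [seq e k | k <- iota 0 n.+1] by rewrite size_map size_iota.
move: (leqnn n.+1); elim: {1 3}n.+1 => [|k IH] kn; first exact: nil_free.
have -> : iota 0 k.+1 = iota 0 k ++ [:: k] by rewrite -[k.+1]addn1 iotaD.
rewrite map_cat /= -(perm_free (permEl (perm_catC [:: _] _))) free_cons.
rewrite (IH (ltnW kn)) andbT; apply/negP => ek.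
have : r (ugen q GEm ^+ k) *m e k \in 0%VS.
  move: ek; apply: mulmx_span => v /mapP[j]; rewrite mem_iota add0n /= => jk ->.
  by rewrite memv0 lower_pow_raise_pow //; exact: leq_trans (ltnW jk) kn.
by rewrite memv0 lower_pow_raise_pow // ltnn.
Qed.

End Lowest.

Section Unique.
Variables (n : nat) (x : 'cV[F]_N).
Hypotheses (lx : lowest n%:Z x) (x0 : x != 0).
Hypothesis uniq_low : forall y, lowest n%:Z y -> exists c, y = c *: x.

(** In an arbitrary submodule, a vector killed by the lowering operator might be
    a sum of vectors of several weights; the Casimir rules this out. *)
Lemma low_unique v : C *m v = cas_val q n%:Z *: v -> L *m v = 0 ->
  exists c, v = c *: x.
Proof.
move=> Cv Lv; apply: uniq_low; split=> //; apply/subr0_eq.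
(* On the kernel of the lowering operator, the Casimir is a quadratic function
   of [K], whose other root is excluded by its sign. *)
pose u := K *m v - q ^ (- n%:Z) *: v; rewrite -/u.
have KV1 : K *m KV = 1%:M := urepKK r true.
have Lu : L *m u = 0.
  have KL : K *m (L *m v) = q ^- 2 *: (L *m (K *m v)).
    by rewrite !mulmxA urepK1m -scalemxAl.
  rewrite mulmxBr -scalemxAr Lv scaler0 subr0; apply/eqP.
  move/eqP: KL; rewrite Lv mulmx0 eq_sym scaler_eq0 invr_eq0.
  by rewrite expf_eq0 /= (negPf (q_neq0 hq)).
apply: (lower_inj hq wtd (s := n%:Z + 2)) Lu; first by lia.
have : q^-1 *: (K *m v) + q *: (KV *m v) = (q ^ (n%:Z + 1) + q ^ (- n%:Z - 1)) *: v.
  have d0 : (q - q^-1) ^- 2 != 0 by rewrite invr_eq0 expf_neq0 // qqV_neq0.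
  apply: (scalerI d0); rewrite scalerA mulrC -/(cas_val q n%:Z) -Cv.
  by rewrite casE' // mulmxDl -mulmxA Lv mulmx0 add0r -scalemxAl mulmxDl -!scalemxAl.
move/(congr1 (fun w => q *: (K *m w))).
rewrite mulmxDr -!scalemxAr (mulmxA K KV) KV1 mul1mx scalerDr !scalerA.
rewrite divff ?(q_neq0 hq) // scale1r /weight => KKv.
rewrite /u mulmxBr -scalemxAr -[K *m (K *m v)](addrK ((q * q) *: v)) KKv.
apply/matrixP => i j; rewrite !mxE !(qexpzD hq) !qexpzN expr1z.
by have := q_neq0 hq; have := qexpz_neq0 hq n%:Z => *; field; apply/andP.
Qed.

(** Every nonzero submodule contains a vector killed by the lowering operator,
    and such a vector generates everything by [low_unique]. *)
Lemma cyclic_irreducible : calU_irreducible r (cyclic n x).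
Proof.
split=> [|//|W' stW' W'x].
- by apply: contraNneq x0 => W0; rewrite -memv0 -W0 mem_cyclic.
- exact: cyclic_stable lx.
have [->|W'0] := eqVneq W' 0%VS; [by left | right].
have vW' := memv_pick W'; have := W'0; rewrite -vpick0.
move: (vpick W') vW' => v vW' v0.
apply/eqP; rewrite eqEsubv W'x; apply: cyclic_min => //.
have L0 w : w \in cyclic n x -> r (ugen q GEm ^+ n.+1) *m w \in 0%VS.
  apply: mulmx_span => u /mapP[k]; rewrite mem_iota add0n /= => kn ->.
  by rewrite memv0 (lower_pow_raise_pow lx).
have Lst j w : w \in W' -> r (ugen q GEm ^+ j) *m w \in W'.
  move=> wW; elim: j => [|j IH]; first by rewrite expr0 rmorph1 mul1mx.
  by rewrite urepXS -mulmxA; apply: stW' IH; constructor.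
have exL : exists j, r (ugen q GEm ^+ j.+1) *m v == 0.
  by exists n; rewrite -memv0; apply/L0/(subvP W'x).
case: (ex_minnP exL) => j /eqP Lj0 minj.
set w := r (ugen q GEm ^+ j) *m v; have wW : w \in W' by exact: Lst.
have w0 : w != 0.
  rewrite /w; case: j {Lj0 w wW} minj => [|j] minj.
    by rewrite expr0 rmorph1 mul1mx.
  by apply/negP => /minj; rewrite ltnn.
have [|c wx] := low_unique (cyclic_cas lx (subvP W'x _ wW)).
  by rewrite mulmxA -urepXS.
have c0 : c != 0 by apply: contraNneq w0 => c0; rewrite wx c0 scale0r.
by rewrite -(scale1r x) -(mulVf c0) -scalerA -wx memvZ.
Qed.

Lemma cyclic_is_Vtilde : is_Vtilde r n (cyclic n x).
Proof.
split; [exact: cyclic_irreducible | exact: dim_cyclic lx x0 |] => i iN.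
exists (r (ugen q (GE true) ^+ (n - i)) *m x).
split; [apply: mem_raise_pow | apply: (raise_pow_neq0 lx) |]; rewrite ?leq_subr //.
by have := weight_raise_pow lx (n - i); congr (_ *m _ = q ^ _ *: _); lia.
Qed.

(** An irreducible submodule of the given kind contains a vector of weight
    [- n]; descending from it to a lowest weight vector of weight [- n - 2 j]
    produces a submodule of dimension [n + 2 j + 1], which is everything, so that
    [j] vanishes and the vector reached is a multiple of [x]. *)
Lemma Vtilde_cyclic : Vtilde r n = cyclic n x.
Proof.
rewrite /Vtilde; case: xgetP => [W _ [[W0 stW irrW] dimW wtW]|/(_ (cyclic n x))];
  last by have := cyclic_is_Vtilde.
have [w [wW w0 ww]] := wtW n (leqnn n).
have {}ww : weight r (- n%:Z) w by move: ww; congr (_ *m _ = q ^ _ *: _); lia.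
have [j [y0 ly]] := descend ww w0; set y := _ *m w in y0 ly.
have {}ly : lowest (n + 2 * j)%N%:Z y by move: ly; congr lowest; lia.
have yW : y \in W.
  rewrite /y; elim: {y y0 ly} j => [|j IH]; first by rewrite expr0 rmorph1 mul1mx.
  by rewrite urepXS -mulmxA; apply: stW IH; constructor.
have yW' : (cyclic (n + 2 * j) y <= W)%VS by exact: cyclic_min.
have [/eqP|Wy] := irrW _ (cyclic_stable ly) yW'.
  by rewrite -dimv_eq0 dim_cyclic.
have j0 : j = 0%N by move: (dim_cyclic ly y0); rewrite Wy dimW; lia.
have [|c yx] := uniq_low (y := y); first by move: ly; congr lowest; lia.
have c0 : c != 0 by apply: contraNneq y0 => c0; rewrite yx c0 scale0r.
have xW : x \in W by rewrite -(scale1r x) -(mulVf c0) -scalerA -yx memvZ.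
have [/eqP|//] := irrW _ (cyclic_stable lx) (cyclic_min n stW xW).
by rewrite -dimv_eq0 dim_cyclic.
Qed.

(** By induction on the weight, [L *m y] lies in the submodule, and raising it
    gives back [y] up to a scalar. The scalar can only vanish when [s = - n],
    where [y] is itself a lowest weight vector, or above [n], where [y = 0]. *)
Lemma mem_cyclic_cas s y : weight r s y -> C *m y = cas_val q n%:Z *: y ->
  y \in cyclic n x.
Proof.
move=> wy Cy; have [k] : exists k : nat, B%:Z < k%:Z - s by exists (B + `|s|).+1; lia.
elim: k s y wy Cy => [|k IH] s y wy Cy sB.
  by rewrite (weight_big hq wtd wy) ?mem0v //; lia.
have [ns|sn] := ltP n%:Z s; first by rewrite (cas_above hq wtd _ ns Cy wy) ?mem0v.
have LyW : L *m y \in cyclic n x.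
  apply: (IH (s - 2)); [exact: weight_lower | | lia].
  by rewrite mulmxA cas_lower // -mulmxA Cy -scalemxAr.
have := raise_lower hq wy; rewrite Cy -scalerBl => EL.
have [sE|sE] := eqVneq s (- n%:Z).
  have Ly0 : L *m y = 0.
    apply: (raise_inj hq wtd _ (weight_lower hq wy)); first by lia.
    by rewrite EL sE opprK subrr scale0r.
  by have [c ->] := low_unique Cy Ly0; rewrite memvZ ?mem_cyclic.
have c0 : cas_val q n%:Z - cas_val q (- s) != 0.
  by rewrite subr_eq0; apply: cas_val_neq => //; lia.
rewrite -(scale1r y) -(mulVf c0) -scalerA -EL memvZ //.
by apply: (cyclic_stable lx) LyW; constructor.
Qed.

End Unique.
End Cyclic.


(** * Linear maps commuting with the subalgebra *)

Section Maps.
Variables (F : fieldType) (q : F) (hq : q_generic q) (M N : nat).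
Variables (r : urep q M) (s : urep q N) (B : nat).
Hypotheses (wr : weighted r B) (ws : weighted s B).

Section Linear.
Variables (f : 'M[F]_(N, M)) (fU : calU_linear r s f).

Lemma linear_lowest n y : lowest r n y -> lowest s n (f *m y).
Proof.
case=> Ly wy; split.
  by rewrite mulmxA -fU; [rewrite -mulmxA Ly mulmx0 | constructor].
by rewrite /weight mulmxA -fU; [rewrite -mulmxA wy -scalemxAr | constructor].
Qed.

(** A weight vector with nonzero image can be lowered until its image is a lowest
    weight vector. Projecting to the Casimir eigenspace of that image then turns
    the vector itself into a lowest weight vector, without killing its image. *)
Lemma linear_eq0 :
  (forall (nu : nat) y, (nu <= B./2)%N -> lowest r (B%:Z - 2 * nu%:Z) y ->
    f *m y = 0) -> f = 0.
Proof.
move=> f0; suff fv : forall v : 'cV[F]_M, f *m v = 0.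
  apply/matrixP => i j; have := fv (delta_mx j 0).
  by rewrite -colE => /colP/(_ i); rewrite !mxE.
apply: (weighted_ind wr) => [|v w IHv IHw|i v iB]; first exact: mulmx0.
  by rewrite mulmxDr IHv IHw addr0.
have [k] : exists k, (B < i + k)%N by exists B.+1; lia.
elim: k i v {iB} => [|k IH] i v iB wv.
  by rewrite (weight_big hq wr wv) ?mulmx0 //; lia.
have Lfv : s (ugen q GEm) *m (f *m v) = 0.
  rewrite mulmxA -fU; last by constructor.
  rewrite -mulmxA; apply: (IH i.+1); first by lia.
  by have := weight_lower hq wv; congr weight; lia.
have wfv : weight s (B%:Z - 2 * i%:Z) (f *m v).
  by rewrite /weight mulmxA -fU; [rewrite -mulmxA wv -scalemxAr | constructor].
have [pos|neg] := ltP 0 (B%:Z - 2 * i%:Z); first exact: (lower_inj hq ws pos wfv).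
have [iB'|Bi] := leqP i B; last by rewrite (weight_big hq wr wv) ?mulmx0 //; lia.
pose nu := (B - i)%N; have nuB : (nu <= B./2)%N by rewrite /nu; lia.
have nuE : B%:Z - 2 * nu%:Z = - (B%:Z - 2 * i%:Z) by rewrite /nu; lia.
pose v1 := r (horner_alg (cas q) (isotypic q B nu)) *m v.
have Cv1 : r (cas q) *m v1 = cas_val q (B%:Z - 2 * nu%:Z) *: v1.
  exact: isotypic_eigen.
have wv1 : weight r (B%:Z - 2 * i%:Z) v1.
  by rewrite /weight /v1 mulmxA -comm_cas_poly ?cas_K // -mulmxA wv -scalemxAr.
have Lv1 : r (ugen q GEm) *m v1 = 0.
  apply: (raise_inj hq wr _ (weight_lower hq wv1)); first by lia.
  by rewrite (raise_lower hq wv1) Cv1 nuE subrr.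
have fv1 : f *m v1 = (isotypic q B nu).[cas_val q (B%:Z - 2 * nu%:Z)] *: (f *m v).
  rewrite /v1 mulmxA fU; last exact: calU_cas_poly.
  by rewrite -mulmxA (cas_poly_eigen _ (c := cas_val q (B%:Z - 2 * nu%:Z))) // nuE
    (cas_lowest hq wfv Lfv).
have : f *m v1 = 0 by apply: (f0 nu) => //; split; rewrite // nuE opprK.
rewrite fv1 => /eqP; rewrite scaler_eq0 => /orP[|/eqP//].
by rewrite (negPf (isotypic_neq0 _ nuB)).
Qed.

End Linear.

(** Precomposing a map with the Casimir projection isolates the component on
    which it is wanted. *)
Lemma linear_component (f : 'M[F]_(N, M)) (nu n : nat) x x' c :
  calU_linear r s f -> (nu <= B./2)%N -> (n = B - 2 * nu)%N ->
  lowest r n%:Z x -> lowest s n%:Z x' -> x' != 0 ->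
  (forall y, lowest s n%:Z y -> exists d, y = d *: x') ->
  f *m x = c *: x' -> c != 0 ->
  exists g, [/\ calU_linear r s g, forall v, g *m v \in Vtilde s n & g *m x = x'].
Proof.
move=> fU nuB nE lx lx' x'0 uniq fx c0.
have nZ : n%:Z = B%:Z - 2 * nu%:Z by rewrite nE; lia.
pose P := isotypic q B nu; pose pc := P.[cas_val q n%:Z].
have pc0 : pc != 0 by rewrite /pc nZ isotypic_neq0.
pose CP := r (horner_alg (cas q) P).
exists ((c * pc)^-1 *: (f *m CP)); split.
- have CPU : calU_linear r r CP.
    by apply: calU_linearP; rewrite comm_cas_poly ?cas_K ?cas_raise ?cas_lower.
  move=> u uU; rewrite -scalemxAl -scalemxAr mulmxA -fU // -!mulmxA.
  by rewrite CPU.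
- move=> v; rewrite -scalemxAl memvZ //.
  rewrite (Vtilde_cyclic hq ws lx' x'0 uniq).
  move: v; apply: (weighted_ind wr) => [|v w IHv IHw|i v iB wv].
  + by rewrite mulmx0 mem0v.
  + by rewrite mulmxDr memvD.
  apply: (mem_cyclic_cas hq ws lx' x'0 uniq (s := B%:Z - 2 * i%:Z)).
    rewrite /weight !mulmxA -fU; last by constructor.
    by rewrite -(mulmxA f) -comm_cas_poly ?cas_K // -!mulmxA wv -!scalemxAr.
  rewrite !mulmxA -fU; last exact: calU_cas.
  by rewrite -!mulmxA isotypic_eigen // -scalemxAr nZ.
- rewrite -scalemxAl -mulmxA (cas_poly_eigen _ (cas_low hq lx)) -scalemxAr fx.
  by rewrite !scalerA -(mulrA _ pc) (mulrC pc) mulVf ?scale1r // mulf_neq0.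
Qed.

End Maps.


(** * Tensor products of evaluation modules *)

Section TensorBasis.
Variables (F : fieldType) (l m : nat).

Definition tvec (i j : int) : 'cV[F]_(l.+1 * m.+1) := vvec F l i *t vvec F m j.

(** The coefficient of [y] at [tvec i j]. Indices out of range are allowed, and
    give 0: in the equations of [coef_lower] the neighbours of a valid index may
    be out of range. *)
Definition coef (y : 'cV[F]_(l.+1 * m.+1)) (i j : int) : F :=
  ((tvec i j)^T *m y) 0 0.

Lemma tvec0 i j : ~~ ((0 <= i <= l%:Z) && (0 <= j <= m%:Z)) -> tvec i j = 0.
Proof.
by rewrite negb_and /tvec => /orP[] /vvec0 ->; rewrite ?tens0mx ?tensmx0.
Qed.

Lemma mul_tvec n p (A : 'M[F]_(n, l.+1)) (A' : 'M[F]_(p, m.+1)) i j :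
  (A *t A') *m tvec i j = (A *m vvec F l i) *t (A' *m vvec F m j).
Proof. exact: (tensmx_mul A A' (vvec F l i) (vvec F m j)). Qed.

Lemma tr_tvec i j : (tvec i j)^T = (vvec F l i)^T *t (vvec F m j)^T.
Proof. exact: (trmx_tens (vvec F l i) (vvec F m j)). Qed.

Lemma tvec_mul n p (A : 'M[F]_(l.+1, n)) (A' : 'M[F]_(m.+1, p)) i j :
  (tvec i j)^T *m (A *t A') = ((vvec F l i)^T *m A) *t ((vvec F m j)^T *m A').
Proof.
by rewrite tr_tvec; exact: (tensmx_mul (vvec F l i)^T (vvec F m j)^T A A').
Qed.

Lemma tvecE i j k h : tvec i j (mxtens_index (k, h)) 0 =
  (k%:Z == i)%:R * (h%:Z == j)%:R.
Proof. by rewrite mxE mxtens_indexK !mxE. Qed.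

Lemma coefE y (i : 'I_l.+1) (j : 'I_m.+1) :
  coef y i j = y (mxtens_index (i, j)) 0.
Proof.
rewrite /coef mxE (bigD1 (mxtens_index (i, j))) //= big1 ?addr0.
  by rewrite mxE tvecE !eqxx !mul1r.
move=> k; case: (mxtens_indexP k) => [k1 k2]; rewrite mxE tvecE !eqz_nat => kij.
have [/val_inj k1i|] := eqVneq (k1 : nat) i; last by rewrite !mul0r.
have [/val_inj k2j|] := eqVneq (k2 : nat) j; last by rewrite mulr0 mul0r.
by rewrite k1i k2j eqxx in kij.
Qed.

Lemma coef_eq0 y : (forall i j, coef y i j = 0) -> y = 0.
Proof.
move=> y0; apply/colP => k; case: (mxtens_indexP k) => [i j].
by rewrite -coefE y0 mxE.
Qed.

Lemma tvec_expand y : y = \sum_(p : 'I_l.+1 * 'I_m.+1)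
  coef y p.1 p.2 *: tvec p.1 p.2.
Proof.
apply/colP => k; case: (mxtens_indexP k) => [i j]; rewrite summxE.
rewrite (bigD1 (i, j)) //= big1 ?addr0; last first.
  move=> [i' j'] /= ij; rewrite mxE tvecE !eqz_nat.
  have [/val_inj e1|] := eqVneq (i : nat) i'; last by rewrite mul0r mulr0.
  have [/val_inj e2|] := eqVneq (j : nat) j'; last by rewrite !mulr0.
  by rewrite e1 e2 eqxx in ij.
by rewrite mxE tvecE !eqxx !mulr1 coefE.
Qed.

Lemma tvec_ext n (A A' : 'M[F]_(n, l.+1 * m.+1)) :
  (forall i j : nat, A *m tvec i j = A' *m tvec i j) -> A = A'.
Proof.
move=> AA; have AAv (v : 'cV_(l.+1 * m.+1)) : A *m v = A' *m v.
  rewrite (tvec_expand v) !mulmx_sumr.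
  by apply: eq_bigr => p _; rewrite -!scalemxAr AA.
apply/matrixP => i j; have /colP/(_ i) := AAv (delta_mx j 0).
by rewrite -!colE !mxE.
Qed.

Lemma coef_tvec (i j i' j' : int) :
  0 <= i' <= l%:Z -> 0 <= j' <= m%:Z ->
  coef (tvec i j) i' j' = (i == i')%:R * (j == j')%:R.
Proof.
case: i' j' => [i'|//] [j'|//] /= i'l j'm.
have {}i'l : (i' < l.+1)%N by lia.
have {}j'm : (j' < m.+1)%N by lia.
by rewrite (coefE _ (Ordinal i'l) (Ordinal j'm)) tvecE /= ![_ == Posz _]eq_sym.
Qed.

Lemma tvec_map n (z : nat -> nat -> 'cV[F]_n) : exists A : 'M[F]_(n, l.+1 * m.+1),
  forall i j : nat, (i <= l)%N -> (j <= m)%N -> A *m tvec i j = z i j.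
Proof.
exists (\sum_(p : 'I_l.+1 * 'I_m.+1) z p.1 p.2 *m (tvec p.1 p.2)^T) => i j il jm.
have {il jm} [il jm] : (i < l.+1)%N /\ (j < m.+1)%N by [].
pose p0 := (Ordinal il, Ordinal jm).
have tE (p : 'I_l.+1 * 'I_m.+1) : (tvec p.1 p.2)^T *m tvec i j = (p == p0)%:R%:M.
  rewrite [LHS]mx11_scalar -/(coef _ _ _) coef_tvec; last 2 first.
  - by case: p => p1 p2 /=; have := ltn_ord p1; lia.
  - by case: p => p1 p2 /=; have := ltn_ord p2; lia.
  rewrite -natrM mulnb !eqz_nat; case: p => p1 p2; rewrite xpair_eqE -!val_eqE /=.
  by rewrite (eq_sym i) (eq_sym j).
rewrite mulmx_suml (bigD1 p0) //= big1 ?addr0; last first.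
  by move=> p /negPf pp; rewrite -mulmxA tE pp /= raddf0 mulmx0.
by rewrite -mulmxA (tE p0) eqxx mulmx1.
Qed.

Lemma coef_out y i j : ~~ ((0 <= i <= l%:Z) && (0 <= j <= m%:Z)) ->
  coef y i j = 0.
Proof. by move=> /tvec0 ij; rewrite /coef ij trmx0 mul0mx mxE. Qed.

Lemma coefD y z i j : coef (y + z) i j = coef y i j + coef z i j.
Proof. by rewrite /coef mulmxDr mxE. Qed.

Lemma coefZ c y i j : coef (c *: y) i j = c * coef y i j.
Proof. by rewrite /coef -scalemxAr mxE. Qed.

Lemma coef_sum I (t : seq I) (y : I -> 'cV_(l.+1 * m.+1)) i j :
  coef (\sum_(k <- t) y k) i j = \sum_(k <- t) coef (y k) i j.
Proof. by rewrite /coef mulmx_sumr summxE. Qed.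

End TensorBasis.

Section EvalTranspose.
Variables (F : fieldType) (q : F) (l : nat) (a : F).

Lemma vvec_mul_K b i : (vvec F l i)^T *m eval_gen q l a (GK b) =
  q ^ (if b then l%:Z - 2 * i else 2 * i - l%:Z) *: (vvec F l i)^T.
Proof.
apply/rowP => k; rewrite !mxE.
have [il|il] := boolP (0 <= i <= l%:Z); last first.
  rewrite big1 => [|h _]; last by rewrite vvec0 // !mxE mul0r.
  case: eqP => [ki|_]; last by rewrite mulr0.
  by case/negP: il; rewrite -ki; have := ltn_ord k; lia.
case: i il => // i il; have {}il : (i < l.+1)%N by lia.
rewrite (bigD1 (Ordinal il)) //= big1 ?addr0; last first.
  by move=> h; rewrite -val_eqE /= => hi; rewrite !mxE eqz_nat (negPf hi) mul0r.
rewrite !mxE eqxx mul1r eqz_nat.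
by case: b; rewrite !mxE /= !eqz_nat (eq_sym i); case: eqP => [->|_] //=;
  rewrite !mulr0.
Qed.

(** The bound on [i] matters: the equation fails at [i = l + 1], where only the
    left-hand side vanishes. *)
Lemma vvec_mul_lower i : 0 <= i <= l%:Z -> (vvec F l i)^T *m eval_gen q l a GEm =
  qnum q i *: (vvec F l (i - 1))^T.
Proof.
case: i => // i il; have {}il : (i < l.+1)%N by lia.
apply/rowP => k; rewrite !mxE.
rewrite (bigD1 (Ordinal il)) //= big1 ?addr0; last first.
  by move=> h; rewrite -val_eqE /= => hi; rewrite !mxE eqz_nat (negPf hi) mul0r.
rewrite !mxE eqxx mul1r /=.
have -> : (k%:Z == i%:Z - 1) = (i%:Z == k%:Z + 1) by lia.
by case: eqP => [<-|_]; rewrite ?mulr0.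
Qed.

End EvalTranspose.

Section TensorModule.
Variables (F : fieldType) (q : F) (hq : q_generic q) (l m : nat) (a b : F).
Local Notation T := (tens_rep hq (eval_rep hq l a) (eval_rep hq m b)).
Local Notation tv := (tvec F l m).

Lemma tens_repE g : T (ugen q g) =
  tens_gen (eval_rep hq l a) (eval_rep hq m b) g.
Proof. exact: lift_gen. Qed.

Lemma tens_repK i : T (ugen q (GK i)) =
  eval_gen q l a (GK i) *t eval_gen q m b (GK i).
Proof. by rewrite tens_repE /= !lift_gen. Qed.

Lemma tens_repEp i : T (ugen q (GE i)) =
  eval_gen q l a (GK i) *t eval_gen q m b (GE i) +
  eval_gen q l a (GE i) *t 1%:M.
Proof. by rewrite tens_repE /= !lift_gen. Qed.

Lemma tens_repEm : T (ugen q GEm) =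
  1%:M *t eval_gen q m b GEm + eval_gen q l a GEm *t eval_gen q m b (GK false).
Proof. by rewrite tens_repE tens_gen_em !lift_gen. Qed.

Lemma tens_K i j : T (ugen q (GK true)) *m tv i j =
  q ^ (l%:Z + m%:Z - 2 * i - 2 * j) *: tv i j.
Proof.
rewrite tens_repK mul_tvec !eval_gen_basis /= tensmxZl tensmxZr scalerA.
by rewrite -(qexpzD hq); congr (q ^ _ *: _); lia.
Qed.

Lemma tens_raise i j : T (ugen q (GE true)) *m tv i j =
  (q ^ (l%:Z - 2 * i) * qnum q (m%:Z - j + 1)) *: tv i (j - 1) +
  qnum q (l%:Z - i + 1) *: tv (i - 1) j.
Proof.
rewrite tens_repEp mulmxDl !mul_tvec !eval_gen_basis /= mul1mx.
by rewrite !(tensmxZl, tensmxZr) !scalerA [qnum q _ * q ^ _]mulrC.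
Qed.

Lemma tens_lower i j : T (ugen q GEm) *m tv i j =
  qnum q (j + 1) *: tv i (j + 1) +
  (q ^ (2 * j - m%:Z) * qnum q (i + 1)) *: tv (i + 1) j.
Proof.
rewrite tens_repEm mulmxDl !mul_tvec !eval_gen_basis /= mul1mx.
by rewrite !(tensmxZl, tensmxZr) !scalerA [qnum q _ * q ^ _]mulrC.
Qed.

Lemma weight_tvec i j : weight T (l%:Z + m%:Z - 2 * i - 2 * j) (tv i j).
Proof. exact: tens_K. Qed.

Lemma tens_weighted : weighted T (l + m).
Proof.
move=> v; exists (fun i : 'I_(l + m).+1 =>
  \sum_(p : 'I_l.+1 * 'I_m.+1 | inord (p.1 + p.2) == i)
    coef v p.1 p.2 *: tv p.1 p.2); split.
  rewrite {1}(tvec_expand v).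
  exact: (partition_big (fun p : 'I_l.+1 * 'I_m.+1 =>
    inord (p.1 + p.2) : 'I_(l + m).+1) xpredT).
move=> i; apply: weight_sum => p /eqP <-; apply: weightZ.
have := weight_tvec p.1 p.2; congr weight.
case: p => p1 p2 /=; have := ltn_ord p1; have := ltn_ord p2 => p2m p1l.
by rewrite inordK; lia.
Qed.

Lemma coef_weight s y i j : weight T s y -> coef y i j != 0 ->
  s = l%:Z + m%:Z - 2 * i - 2 * j.
Proof.
move=> wy; apply: contraNeq => sij.
have := congr1 (fun z => coef z i j) wy; rewrite coefZ /coef mulmxA tens_repK.
rewrite tvec_mul !vvec_mul_K tensmxZl tensmxZr -tr_tvec.
rewrite -!scalemxAl !mxE mulrA -(qexpzD hq) => /eqP; rewrite -subr_eq0 -mulrBl.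
rewrite mulf_eq0 => /orP[|//]; rewrite subr_eq0 => /eqP/(qexpz_inj hq); lia.
Qed.

Lemma coef_lower y i j : 0 <= i <= l%:Z -> 0 <= j <= m%:Z ->
  coef (T (ugen q GEm) *m y) i j = qnum q j * coef y i (j - 1) +
    qnum q i * q ^ (2 * j - m%:Z) * coef y (i - 1) j.
Proof.
move=> il jm; rewrite /coef mulmxA tens_repEm mulmxDr !tvec_mul.
rewrite !vvec_mul_lower // vvec_mul_K mulmx1 !tensmxZl !tensmxZr -!tr_tvec.
by rewrite mulmxDl scalerA -!scalemxAl !mxE.
Qed.

(** The kernel of the lowering operator embeds into the coefficients at
    [i = l], and into those at [j = m]: its equations determine, starting from
    either end, all the others. *)
Lemma lower_ker_l y : T (ugen q GEm) *m y = 0 ->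
  (forall j, coef y l j = 0) -> y = 0.
Proof.
move=> Ly yl; apply: coef_eq0.
suff yk (k : nat) j : coef y (l%:Z - k%:Z) j = 0.
  move=> i j; have [il|il] := boolP (0 <= i <= l%:Z); last first.
    by rewrite coef_out // negb_and il.
  by rewrite -(yk `|l%:Z - i|%N j); congr coef; lia.
elim: k j => [|k IH] j; first by rewrite subr0.
have [/andP[il jm]|] := boolP ((0 <= l%:Z - k.+1%:Z <= l%:Z) && (0 <= j <= m%:Z));
  last exact: coef_out.
have kl : 0 <= l%:Z - k%:Z <= l%:Z by lia.
have := coef_lower y kl jm; rewrite Ly IH mulr0 add0r {1}/coef mulmx0 mxE.
move=> /esym/eqP; rewrite 2!mulf_eq0 (negPf (qexpz_neq0 hq _)) orbF.
rewrite (negPf (qnum_neq0 hq _)) ?orFb; last by lia.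
by move=> /eqP <-; congr coef; lia.
Qed.

Lemma lower_ker_m y : T (ugen q GEm) *m y = 0 ->
  (forall i, coef y i m = 0) -> y = 0.
Proof.
move=> Ly ym; apply: coef_eq0.
suff yk (k : nat) i : coef y i (m%:Z - k%:Z) = 0.
  move=> i j; have [jm|jm] := boolP (0 <= j <= m%:Z); last first.
    by rewrite coef_out // negb_and jm orbT.
  by rewrite -(yk `|m%:Z - j|%N i); congr coef; lia.
elim: k i => [|k IH] i; first by rewrite subr0.
have [/andP[il jm]|] := boolP ((0 <= i <= l%:Z) && (0 <= m%:Z - k.+1%:Z <= m%:Z));
  last exact: coef_out.
have km : 0 <= m%:Z - k%:Z <= m%:Z by lia.
have := coef_lower y il km; rewrite Ly IH mulr0 addr0 {1}/coef mulmx0 mxE.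
move=> /esym/eqP; rewrite mulf_eq0 (negPf (qnum_neq0 hq _)) ?orFb; last by lia.
by move=> /eqP <-; congr coef; lia.
Qed.

Lemma lowest_big (nu : nat) y : (minn l m < nu)%N ->
  lowest T (l%:Z + m%:Z - 2 * nu%:Z) y -> y = 0.
Proof.
move=> nulm [Ly wy]; have [mnu|num] := ltnP m nu.
  apply: lower_ker_l => // j; apply/eqP/negP => /negP yj.
  by have e := coef_weight wy yj; case/negP: yj; rewrite coef_out //; lia.
apply: lower_ker_m => // i; apply/eqP/negP => /negP yi.
by have e := coef_weight wy yi; case/negP: yi; rewrite coef_out //; lia.
Qed.

Section Lowest.
Variable nu : nat.
Hypothesis nulm : (nu <= minn l m)%N.
Local Notation x := (lowest_vec q l m nu).

Lemma lowest_vecE : x = \sum_(j < nu.+1)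
  ((-1) ^+ j * q ^ (j%:Z * (m%:Z - j%:Z + 1)) *
   qfact q (l - nu + j) * qfact q (m - j)) *:
  tv (l%:Z - nu%:Z + j%:Z) (m%:Z - j%:Z).
Proof.
apply: eq_bigr => j _; have := ltn_ord j => jnu.
rewrite -[q ^+ _]/(q ^ (j * (m - j + 1))%N%:Z).
congr ((_ * q ^ _ * _ * _) *: (vvec _ _ _ *t vvec _ _ _)); nia.
Qed.

Lemma coef_lowest_vec : coef x l (m%:Z - nu%:Z) != 0.
Proof.
rewrite lowest_vecE coef_sum big_ord_recr /= big1 ?add0r; last first.
  move=> j _; rewrite coefZ coef_tvec; [|lia|lia].
  have -> : (l%:Z - nu%:Z + j%:Z == l%:Z) = false by have := ltn_ord j; lia.
  by rewrite mul0r mulr0.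
rewrite coefZ coef_tvec; [|lia|lia].
have -> : (l%:Z - nu%:Z + nu%:Z == l%:Z) by lia.
rewrite eqxx !mulr1 !mulf_neq0 ?qfact_neq0 ?qexpz_neq0 //.
by rewrite signr_eq0.
Qed.

Lemma lowest_vec_neq0 : x != 0.
Proof.
by apply: contraNneq coef_lowest_vec => ->; rewrite /coef mulmx0 mxE.
Qed.

Lemma lowest_vec_lowest : lowest T (l%:Z + m%:Z - 2 * nu%:Z) x.
Proof.
rewrite lowest_vecE; split; last first.
  apply: weight_sum => j _; apply: weightZ.
  by have := weight_tvec (l%:Z - nu%:Z + j%:Z) (m%:Z - j%:Z); congr weight; lia.
rewrite mulmx_sumr; under eq_bigr => j _ do
  rewrite -scalemxAr tens_lower scalerDr !scalerA.
rewrite big_split /= big_ord_recl big_ord_recr /=.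
rewrite (@tvec0 _ _ _ _ (m%:Z - 0%:Z + 1)) ?scaler0 ?add0r; last by lia.
rewrite (@tvec0 _ _ _ (l%:Z - nu%:Z + nu%:Z + 1)) ?scaler0 ?addr0; last by lia.
rewrite -big_split /= big1 // => j _; have jnu := ltn_ord j.
rewrite /bump leq0n add1n.
have -> : tv (l%:Z - nu%:Z + j.+1%:Z) (m%:Z - j.+1%:Z + 1) =
  tv (l%:Z - nu%:Z + j%:Z + 1) (m%:Z - j%:Z) by congr tvec; lia.
rewrite -scalerDl [X in X *: _](_ : _ = 0) ?scale0r //.
rewrite addnS qfactS (_ : (m - j = (m - j.+1).+1)%N); last by lia.
rewrite qfactS exprS.
have -> : (l - nu + j).+1%:Z = l%:Z - nu%:Z + j%:Z + 1 by lia.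
have -> : (m - j.+1).+1%:Z = m%:Z - j.+1%:Z + 1 by lia.
have -> : q ^ (j.+1%:Z * (m%:Z - j.+1%:Z + 1)) =
  q ^ (j%:Z * (m%:Z - j%:Z + 1)) * q ^ (2 * (m%:Z - j%:Z) - m%:Z).
  by rewrite -(qexpzD hq); congr (q ^ _); nia.
by ring.
Qed.

(** Such a vector has at most one nonzero coefficient at [i = l], the one at
    [j = m - nu]; it is nonzero for [x]. *)
Lemma lowest_vec_unique y : lowest T (l%:Z + m%:Z - 2 * nu%:Z) y ->
  exists c, y = c *: x.
Proof.
move=> [Ly wy]; pose c := coef y l (m%:Z - nu%:Z) / coef x l (m%:Z - nu%:Z).
exists c; apply/subr0_eq; have [Lx wx] := lowest_vec_lowest.
apply: lower_ker_l => [|j]; first by rewrite mulmxBr -scalemxAr Ly Lx scaler0 subrr.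
rewrite coefD -scaleNr coefZ.
have [->|jE] := eqVneq j (m%:Z - nu%:Z).
  by rewrite /c mulNr mulfVK ?subrr ?coef_lowest_vec.
have out z : weight T (- (l%:Z + m%:Z - 2 * nu%:Z)) z -> coef z l j = 0.
  by move=> wz; apply/eqP/negP => /negP/(coef_weight wz); lia.
by rewrite !out // mulr0 addr0.
Qed.

End Lowest.
End TensorModule.


(** * The action of e_0 *)

Section Shifts.
Variables (F : fieldType) (q : F) (hq : q_generic q) (l m : nat) (a : F).
Local Notation T := (VW hq l m a).
Local Notation T' := (WV hq l m a).
Local Notation tv := (tvec F l m).
Local Notation tv' := (tvec F m l).
Local Notation E := (T (ugen q (GE true))).
Local Notation E' := (T' (ugen q (GE true))).
Local Notation Y := (T (ugen q GEm)).
Local Notation Y' := (T' (ugen q GEm)).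
Local Notation KV := (T (ugen q (GK false))).
Local Notation KV' := (T' (ugen q (GK false))).

(** Up to the factor [a * q], the action of [e_0^+] on the two tensor products:
    see [VW_E0] and [WV_E0]. *)
Definition shift : 'M[F]_(l.+1 * m.+1) := eval_gen q l a GEm *t 1%:M.
Definition shift' : 'M[F]_(m.+1 * l.+1) :=
  eval_gen q m 0 (GK false) *t eval_gen q l a GEm.
Local Notation X := shift.
Local Notation X' := shift'.

Lemma eval_gen_E0 (n : nat) b :
  eval_gen q n b (GE false) = (b * q) *: eval_gen q n b GEm.
Proof. by apply/matrixP => i j; rewrite !mxE mulrA. Qed.

Lemma VW_E0 : T (ugen q (GE false)) = (a * q) *: X.
Proof.
by rewrite tens_repEp !eval_gen_E0 mul0r scale0r tensmx0 add0r tensmxZl.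
Qed.

Lemma WV_E0 : T' (ugen q (GE false)) = (a * q) *: X'.
Proof.
by rewrite tens_repEp !eval_gen_E0 mul0r scale0r tens0mx addr0 tensmxZr.
Qed.

Lemma shiftE i j : X *m tv i j = qnum q (i + 1) *: tv (i + 1) j.
Proof. by rewrite mul_tvec eval_gen_basis mul1mx tensmxZl. Qed.

Lemma shift'E j i :
  X' *m tv' j i = (q ^ (2 * j - m%:Z) * qnum q (i + 1)) *: tv' j (i + 1).
Proof. by rewrite mul_tvec !eval_gen_basis tensmxZl tensmxZr scalerA. Qed.

Lemma tens_KV i j : KV *m tv i j = q ^ (2 * i + 2 * j - l%:Z - m%:Z) *: tv i j.
Proof.
by rewrite (weightV hq (weight_tvec hq _ _ _ _ i j)); congr (q ^ _ *: _); lia.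
Qed.

Lemma tens_KV' i j : KV' *m tv' i j = q ^ (2 * i + 2 * j - l%:Z - m%:Z) *: tv' i j.
Proof.
by rewrite (weightV hq (weight_tvec hq _ _ _ _ i j)); congr (q ^ _ *: _); lia.
Qed.

Lemma shift_low nu : (nu < minn l m)%N ->
  X *m lowest_vec q l m nu.+1 = lowest_vec q l m nu.
Proof.
move=> nulm; rewrite !lowest_vecE ?(ltnW nulm) // mulmx_sumr big_ord_recr /=.
rewrite -scalemxAr shiftE.
rewrite (@tvec0 _ _ _ (l%:Z - nu.+1%:Z + nu.+1%:Z + 1)) //; last by lia.
rewrite !scaler0 addr0; apply: eq_bigr => j _; have jnu := ltn_ord j.
rewrite -scalemxAr shiftE scalerA.
rewrite (_ : (l - nu + j = (l - nu.+1 + j).+1)%N); last by lia.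
rewrite qfactS.
have -> : (l - nu.+1 + j).+1%:Z = l%:Z - nu.+1%:Z + j%:Z + 1 by lia.
have -> : l%:Z - nu%:Z + j%:Z = l%:Z - nu.+1%:Z + j%:Z + 1 by lia.
by congr (_ *: _); ring.
Qed.

Lemma shift'_low nu : (nu < minn l m)%N ->
  X' *m lowest_vec q m l nu.+1 =
  (- q ^ (l%:Z + m%:Z - 2 * nu%:Z)) *: lowest_vec q m l nu.
Proof.
move=> nulm; rewrite minnC in nulm.
rewrite !lowest_vecE ?(ltnW nulm) // mulmx_sumr big_ord_recl /=.
rewrite -scalemxAr shift'E (@tvec0 _ _ _ _ (l%:Z - 0%:Z + 1)) //; last by lia.
rewrite !scaler0 add0r scaler_sumr; apply: eq_bigr => j _; have jnu := ltn_ord j.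
rewrite -scalemxAr shift'E !scalerA /bump leq0n add1n.
rewrite (_ : (m - nu.+1 + j.+1 = m - nu + j)%N); last by lia.
rewrite (_ : (l - j = (l - j.+1).+1)%N); last by lia.
rewrite qfactS exprS.
have -> : (l - j.+1).+1%:Z = l%:Z - j.+1%:Z + 1 by lia.
have -> : l%:Z - j%:Z = l%:Z - j.+1%:Z + 1 by lia.
have -> : m%:Z - nu.+1%:Z + j.+1%:Z = m%:Z - nu%:Z + j%:Z by lia.
congr (_ *: _).
have -> : - q ^ (l%:Z + m%:Z - 2 * nu%:Z) *
   ((-1) ^+ j * q ^ (j%:Z * (l%:Z - j.+1%:Z + 1 + 1)) * qfact q (m - nu + j) *
    (qfact q (l - j.+1) * qnum q (l%:Z - j.+1%:Z + 1))) =
  (q ^ (l%:Z + m%:Z - 2 * nu%:Z) * q ^ (j%:Z * (l%:Z - j.+1%:Z + 1 + 1))) *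
  (- (-1) ^+ j * qfact q (m - nu + j) *
    (qfact q (l - j.+1) * qnum q (l%:Z - j.+1%:Z + 1))) by ring.
rewrite -(qexpzD hq).
have -> : l%:Z + m%:Z - 2 * nu%:Z + j%:Z * (l%:Z - j.+1%:Z + 1 + 1) =
  (2 * (m%:Z - nu%:Z + j%:Z) - m%:Z) + j.+1%:Z * (l%:Z - j.+1%:Z + 1) by nia.
by rewrite (qexpzD hq (2 * _ - _)); ring.
Qed.

Lemma shift'_lower : X' *m Y' = Y' *m X'.
Proof.
apply: tvec_ext => j i; rewrite -!mulmxA tens_lower shift'E mulmxDr -!scalemxAr.
rewrite !shift'E tens_lower scalerDr !scalerA.
congr (_ *: _ + _ *: _); first by ring.
rewrite [2 * (i%:Z + 1)]mulrDr [2 * (j%:Z + 1)]mulrDr !(qexpzD hq); ring.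
Qed.

(** [E] and [X] do not commute, but [E *m X - q ^- 2 *: (X *m E)] is an affine
    function of a matrix [twist] whose commutation relations with [X] and [Y]
    are closed. On the other tensor product, the analogue [twist'] is not a
    diagonal matrix: it is found by solving [raise_shift'] for it, and turns out
    to satisfy the same relations. *)
Definition twist : 'M[F]_(l.+1 * m.+1) := eval_gen q l a (GK false) *t 1%:M.
Definition twist' : 'M[F]_(m.+1 * l.+1) :=
  1%:M *t eval_gen q l a (GK false) - (q^-1 * (q - q^-1) ^+ 2) *:
    ((eval_gen q m 0 (GE true) *m eval_gen q m 0 (GK false)) *t
     eval_gen q l a GEm).
Local Notation k := twist.
Local Notation k' := twist'.

Definition twist_cst : F :=
  (1 - q ^- 2) * (q ^ (l%:Z + 1) + q ^ (- l%:Z - 1)) / (q - q^-1) ^+ 2.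
Definition twist_lin : F := q^-1 * (q + q^-1) / (q - q^-1).

Lemma twistE i j : k *m tv i j = q ^ (2 * i - l%:Z) *: tv i j.
Proof. by rewrite mul_tvec eval_gen_basis mul1mx tensmxZl. Qed.

Lemma twist'E j i : k' *m tv' j i = q ^ (2 * i - l%:Z) *: tv' j i -
  (q^-1 * (q - q^-1) ^+ 2 * q ^ (2 * j - m%:Z) * qnum q (m%:Z - j + 1) *
   qnum q (i + 1)) *: tv' (j - 1) (i + 1).
Proof.
rewrite mulmxBl -scalemxAl !mul_tvec mul1mx -mulmxA !eval_gen_basis /=.
rewrite -scalemxAr eval_gen_basis /=.
by rewrite !tensmxZl !tensmxZr !scalerA !mulrA.
Qed.

Let q0 : q != 0 := q_neq0 hq.
Let qq0 : q * q - 1 != 0.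
Proof.
have -> : q * q - 1 = q * (q - q^-1) by field.
by rewrite mulf_neq0 ?qqV_neq0.
Qed.
Let q2E i : q ^ (2 * i) = q ^ i * q ^ i.
Proof. by rewrite -(qexpzD hq); congr (_ ^ _); lia. Qed.
Let lin := (addrK, subrK).

(* The powers of [q] are split into those of exponents [i], [j], [l] and [m],
   over which the relations are identities of rational functions. *)
Ltac qfield :=
  rewrite /twist_lin /twist_cst /qnum ?(opprD, opprK) ?(qexpzD hq) ?qexpzN
    ?q2E ?(qexpzD hq) ?qexpzN ?invfM ?invrK ?expr1z;
  by field; rewrite ?(qexpz_neq0 hq) ?q0 ?qq0 ?oner_eq0.

Lemma raise_shift : E *m X = q ^- 2 *: (X *m E) + twist_cst%:M - twist_lin *: k.
Proof.
apply: tvec_ext => i j; rewrite !mulmxDl mulNmx -!scalemxAl mul_scalar_mx -!mulmxA.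
rewrite !(shiftE, tens_raise, twistE, mulmxDr) -!scalemxAr !tens_raise !shiftE !lin.
move: (tv i j) (tv (i%:Z + 1) (j%:Z - 1)) => u v.
apply/colP => h; rewrite !mxE.
qfield.
Qed.

Lemma raise_shift' :
  E' *m X' = q ^- 2 *: (X' *m E') + twist_cst%:M - twist_lin *: k'.
Proof.
apply: tvec_ext => j i; rewrite !mulmxDl mulNmx -!scalemxAl mul_scalar_mx -!mulmxA.
rewrite !(shift'E, tens_raise, twist'E, mulmxDr) -!scalemxAr.
rewrite !tens_raise !shift'E !lin.
move: (tv' j i) (tv' (j%:Z - 1) (i%:Z + 1)) => u v.
apply/colP => h; rewrite !mxE.
qfield.
Qed.

Lemma twist_shift : k *m X = q ^+ 2 *: (X *m k).
Proof.
apply: tvec_ext => i j; rewrite -!scalemxAl -!mulmxA !(shiftE, twistE) -!scalemxAr.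
rewrite !(shiftE, twistE) !scalerA; congr (_ *: _).
qfield.
Qed.

Lemma twist'_shift' : k' *m X' = q ^+ 2 *: (X' *m k').
Proof.
apply: tvec_ext => j i; rewrite -!scalemxAl -!mulmxA !(shift'E, twist'E).
rewrite mulmxBr -!scalemxAr !(shift'E, twist'E).
move: (tv' j (i%:Z + 1)) (tv' (j%:Z - 1) (i%:Z + 1 + 1)) => u v.
apply/colP => h; rewrite !mxE.
qfield.
Qed.

Lemma twist_lower : k *m Y = Y *m k + (q ^+ 2 - 1) *: (X *m KV).
Proof.
apply: tvec_ext => i j; rewrite mulmxDl -!scalemxAl -!mulmxA.
rewrite !(twistE, tens_KV, tens_lower) !mulmxDr -!scalemxAr.
rewrite !(twistE, shiftE, tens_lower).
move: (tv i (j%:Z + 1)) (tv (i%:Z + 1) j) => u v.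
apply/colP => h; rewrite !mxE.
qfield.
Qed.

Lemma twist'_lower' : k' *m Y' = Y' *m k' + (q ^+ 2 - 1) *: (X' *m KV').
Proof.
apply: tvec_ext => j i; rewrite mulmxDl -!scalemxAl -!mulmxA.
rewrite !(twist'E, tens_KV', tens_lower) !(mulmxDr, mulmxN) -!scalemxAr.
rewrite !(twist'E, shift'E, tens_lower) !lin.
move: (tv' j (i%:Z + 1)) (tv' (j%:Z + 1) i) (tv' (j%:Z - 1) (i%:Z + 1 + 1)) => u v w.
apply/colP => h; rewrite !mxE.
qfield.
Qed.

End Shifts.


(** * Existence of an intertwiner *)

Lemma foldl_rev_comm (T : Type) (I : Type) (f : T -> I -> T) v (s : seq I) :
  right_commutative f -> foldl f v (rev s) = foldl f v s.
Proof.
move=> fC; rewrite foldl_rev; elim: s v => //= c s IH v; rewrite IH.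
by elim: s v {IH} => //= d s IH v; rewrite IH fC.
Qed.

Section Exchange.
Variables (F : fieldType) (q : F) (hq : q_generic q) (l m : nat) (a : F).
Local Notation T := (VW hq l m a).
Local Notation T' := (WV hq l m a).
Local Notation tv := (tvec F l m).
Local Notation tv' := (tvec F m l).
Local Notation K' := (T' (ugen q (GK true))).
Local Notation E := (T (ugen q (GE true))).
Local Notation E' := (T' (ugen q (GE true))).
Local Notation Y := (T (ugen q GEm)).
Local Notation Y' := (T' (ugen q GEm)).
Local Notation X := (shift q l m a).
Local Notation X' := (shift' q l m a).

Definition chain_step (v : 'cV[F]_(m.+1 * l.+1)) (c : F) := Y' *m v - c *: (X' *m v).

(** In the source, [tv 0 k] is, up to a scalar, the image of [tv 0 0] under
    [(1 ⊗ e_1^-) ^ k], which is the product of the [Y - q ^ (2 i - m) X] for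
    [i < k] on that vector; [row_image k] is the same product in the target. *)
Definition row_image (k : nat) :=
  foldl chain_step (tv' 0 0) [seq q ^ (2 * i%:Z - m%:Z) | i : nat <- iota 0 k].

Lemma row_imageS k :
  row_image k.+1 = chain_step (row_image k) (q ^ (2 * k%:Z - m%:Z)).
Proof. by rewrite /row_image -[k.+1]addn1 iotaD map_cat foldl_cat. Qed.

Lemma chain_stepC : right_commutative chain_step.
Proof.
move=> v c d; rewrite /chain_step !mulmxBr -!scalemxAr.
rewrite !(mulmxA Y' X') -!shift'_lower //.
by rewrite -!mulmxA; apply/colP => h; rewrite !mxE; ring.
Qed.

(** The commuting factors [Y' - q ^ (2 i - m) X'], for [i <= m], can be applied in
    the opposite order. Each of them then cancels the [tv' n 1] component of the
    image of [tv' n 0], which moves to a multiple of [tv' (n + 1) 0]; the last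
    one leaves the range of indices. *)
Lemma row_image_top : row_image m.+1 = 0.
Proof.
rewrite /row_image -foldl_rev_comm; last exact: chain_stepC.
have -> : rev [seq q ^ (2 * i%:Z - m%:Z) | i : nat <- iota 0 m.+1] =
    [seq q ^ (m%:Z - 2 * i%:Z) | i : nat <- iota 0 m.+1].
  apply: (@eq_from_nth _ 0); first by rewrite size_rev !size_map.
  move=> i; rewrite size_rev size_map size_iota => im.
  rewrite nth_rev size_map size_iota // !(nth_map 0%N) ?size_iota //; last by lia.
  by rewrite !nth_iota //; [congr (q ^ _) | ]; lia.
have chain n : exists c, foldl chain_step (tv' 0 0)
    [seq q ^ (m%:Z - 2 * i%:Z) | i : nat <- iota 0 n] = c *: tv' n 0; last first.
  by have [c ->] := chain m.+1; rewrite tvec0 ?scaler0 //; lia.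
elim: n => [|n [c IH]]; first by exists 1; rewrite scale1r.
have -> : iota 0 n.+1 = iota 0 n ++ [:: n] by rewrite -[n.+1]addn1 iotaD.
rewrite map_cat foldl_cat {}IH /= /chain_step.
exists (c * (q ^ (2 * 0 - l%:Z) * qnum q (n%:Z + 1))).
rewrite -!scalemxAr tens_lower shift'E.
rewrite (scalerA _ c) [_ * c]mulrC -(scalerA c (q ^ _)) -scalerBr.
rewrite (scalerA (q ^ (m%:Z - _))) mulrA -(qexpzD hq).
have -> : m%:Z - 2 * n%:Z + (2 * n%:Z - m%:Z) = 0 by lia.
rewrite expr0z mul1r addrAC subrr add0r scalerA mulrA.
by congr (_ *: tvec _ _ _ _ _); lia.
Qed.

Definition exchange_image (i k : nat) := X' ^+ i *m row_image k.

Lemma exchange_image_shift i k : X' *m exchange_image i k = exchange_image i.+1 k.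
Proof. by rewrite /exchange_image exprS mulmxA. Qed.

Lemma exchange_image_lower i k : Y' *m exchange_image i k =
  exchange_image i k.+1 + q ^ (2 * k%:Z - m%:Z) *: exchange_image i.+1 k.
Proof.
elim: i => [|i IH].
  rewrite -exchange_image_shift /exchange_image expr0 !mul1mx.
  by rewrite row_imageS /chain_step subrK.
rewrite -exchange_image_shift mulmxA -shift'_lower // -mulmxA IH mulmxDr -scalemxAr.
by rewrite !exchange_image_shift.
Qed.

Lemma exchange_image_top i k : (m < k)%N -> exchange_image i k = 0.
Proof.
move=> mk; suff row0 : row_image k = 0 by rewrite /exchange_image row0 mulmx0.
rewrite -(subnKC mk); elim: (k - _)%N => [|j IH].
  by rewrite addn0 row_image_top.
by rewrite addnS row_imageS IH /chain_step !mulmx0 scaler0 subrr.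
Qed.

Lemma exchange_image_right i k : (l < i)%N -> exchange_image i k = 0.
Proof.
move=> li; suff X0 : X' ^+ i = 0 by rewrite /exchange_image X0 mul0mx.
have pow n j h : exists c, X' ^+ n *m tv' j h = c *: tv' j (h + n%:Z).
  elim: n => [|n [c IH]]; first by exists 1; rewrite expr0 mul1mx scale1r addr0.
  exists (c * (q ^ (2 * j - m%:Z) * qnum q (h + n%:Z + 1))).
  rewrite exprS -mulmxA IH -scalemxAr shift'E scalerA.
  by congr (_ *: tvec _ _ _ _ _); lia.
apply: tvec_ext => j h; have [c ->] := pow i j%:Z h%:Z.
by rewrite mul0mx tvec0 ?scaler0 //; lia.
Qed.

Lemma weight_shift' s v : weight T' s v -> weight T' (s - 2) (X' *m v).
Proof.
have KX : K' *m X' = q ^- 2 *: (X' *m K').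
  apply: tvec_ext => j i; rewrite -scalemxAl -!mulmxA shift'E tens_K -!scalemxAr.
  rewrite shift'E tens_K !scalerA; congr (_ *: _).
  have -> : m%:Z + l%:Z - 2 * j%:Z - 2 * (i%:Z + 1) =
    - 2 + (m%:Z + l%:Z - 2 * j%:Z - 2 * i%:Z) by lia.
  by rewrite (qexpzD hq (- 2)) -[q ^- 2]/(q ^ (- 2)); ring.
rewrite /weight mulmxA KX -scalemxAl -mulmxA => ->.
by rewrite -scalemxAr scalerA (qexpzD hq) mulrC.
Qed.

Lemma weight_exchange_image i k :
  weight T' (l%:Z + m%:Z - 2 * i%:Z - 2 * k%:Z) (exchange_image i k).
Proof.
elim: i => [|i IH]; last first.
  by have := weight_shift' IH; rewrite exchange_image_shift; congr weight; lia.
elim: k => [|k IH].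
  rewrite /exchange_image expr0 mul1mx.
  by have := weight_tvec hq m l 0 a 0 0; congr weight; lia.
have := weight_lower hq IH; rewrite exchange_image_lower => wD.
have := weight_shift' IH.
rewrite exchange_image_shift; move: wD; rewrite /weight mulmxDr -scalemxAr => wD wX.
move: wD; rewrite wX scalerDr !scalerA mulrC => /addIr.
by congr (_ = q ^ _ *: _); lia.
Qed.

(** The vector [tv 0 0] generates the source under [X] and [Y]. *)
Lemma shift_lower_generate n (A : 'M[F]_(n, _)) P Q :
  A *m X = P *m A -> A *m Y = Q *m A -> A *m tv 0 0 = 0 -> A = 0.
Proof.
move=> AX AY A0; have stepX i j : A *m tv i%:Z j = 0 -> A *m tv i.+1%:Z j = 0.
  move=> Aij; have : A *m (X *m tv i j) = 0 by rewrite mulmxA AX -mulmxA Aij mulmx0.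
  rewrite shiftE -scalemxAr => /eqP.
  rewrite scaler_eq0 (negPf (qnum_neq0 hq _)); last by lia.
  by move=> /eqP <-; congr (_ *m tvec _ _ _ _ _); lia.
have A0j (j : nat) : A *m tv 0 j = 0.
  elim: j => [//|j IH]; have := tens_lower hq l m a 0 0 j.
  move=> /(congr1 (mulmx A)); rewrite mulmxA AY -mulmxA IH mulmx0 mulmxDr -!scalemxAr.
  rewrite (stepX 0%N j IH) scaler0 addr0 => /esym/eqP.
  rewrite scaler_eq0 (negPf (qnum_neq0 hq _)); last by lia.
  move=> /eqP <-.
  by congr (_ *m tvec _ _ _ _ _); lia.
apply: tvec_ext => i j; rewrite mul0mx; elim: i => [|i IH]; first exact: A0j.
exact: stepX.
Qed.

(** The map sends a monomial in the commuting operators [X] and [Y], applied to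
    [tv 0 0], to the same monomial in [X'] and [Y'], applied to [tv' 0 0]. It is
    well defined because the relations [X ^ (l + 1) = 0] and [row_image_top] of
    the source hold in the target. It commutes with [E]: the twists, then [E],
    satisfy the same relations with [X] and [Y] on both sides, and act alike on
    the generating vectors. *)
Lemma exchange_exists : exists S : 'M[F]_(m.+1 * l.+1, l.+1 * m.+1),
  [/\ calU_linear T T' S, S *m X = X' *m S & S != 0].
Proof.
have [S S0] := tvec_map l m
  (fun i k => (qfact q i * qfact q k)^-1 *: exchange_image i k).
have {S0} SE (i k : nat) :
    S *m tv i k = (qfact q i * qfact q k)^-1 *: exchange_image i k.
  have [il|li] := leqP i l; last first.
    by rewrite exchange_image_right // scaler0 tvec0 ?mulmx0 //; lia.
  have [km|mk] := leqP k m; first exact: S0.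
  by rewrite exchange_image_top // scaler0 tvec0 ?mulmx0 //; lia.
have qf n : qfact q n != 0 by exact: qfact_neq0.
have qfS n : qnum q (n%:Z + 1) * (qfact q n.+1)^-1 = (qfact q n)^-1.
  have -> : n%:Z + 1 = n.+1%:Z by lia.
  by rewrite qfactS invfM mulrCA mulfV ?mulr1 //; apply: qnum_neq0.
have SX : S *m X = X' *m S.
  apply: tvec_ext => i k; rewrite -!mulmxA shiftE -scalemxAr SE -scalemxAr.
  have -> : tv (i%:Z + 1) k = tv i.+1 k by congr tvec; lia.
  by rewrite exchange_image_shift SE scalerA !invfM mulrA qfS.
have SY : S *m Y = Y' *m S.
  apply: tvec_ext => i k; rewrite -!mulmxA tens_lower mulmxDr.
  rewrite -!scalemxAr SE -scalemxAr.
  have -> : tv (i%:Z + 1) k = tv i.+1 k by congr tvec; lia.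
  have -> : tv i (k%:Z + 1) = tv i k.+1 by congr tvec; lia.
  rewrite !SE exchange_image_lower scalerDr !scalerA !invfM; congr (_ *: _ + _ *: _).
    by rewrite mulrCA qfS.
  by rewrite -mulrA (mulrA (qnum _ _)) qfS mulrC.
have SK : S *m T (ugen q (GK true)) = K' *m S.
  apply: tvec_ext => i k; rewrite -!mulmxA tens_K -scalemxAr SE.
  by rewrite -scalemxAr weight_exchange_image scalerA [RHS]scalerA mulrC.
have S00 : S *m tv 0 0 = tv' 0 0.
  rewrite (SE 0%N 0%N) /exchange_image expr0 mul1mx /qfact big_nil.
  by rewrite mulr1 invr1 scale1r.
have SKV : S *m T (ugen q (GK false)) = T' (ugen q (GK false)) *m S.
  exact: (commK_inv (i := true)).
pose k := twist q l m a; pose k' := twist' q l m a.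
have Sk : S *m k = k' *m S.
  apply/subr0_eq; apply: (shift_lower_generate (P := q ^+ 2 *: X') (Q := Y')).
  - rewrite mulmxBl mulmxBr -!mulmxA SX twist_shift // !mulmxA twist'_shift' //.
    by rewrite -!scalemxAr -!scalemxAl !mulmxA SX.
  - rewrite mulmxBl mulmxBr -!mulmxA SY twist_lower // !mulmxA twist'_lower' //.
    rewrite mulmxDr mulmxDl -!scalemxAr -!scalemxAl !mulmxA SX SY -!mulmxA SKV.
    by rewrite opprD addrACA subrr addr0.
  - rewrite mulmxBl -!mulmxA S00 twistE twist'E -scalemxAr S00.
    by rewrite [tv' (0 - 1) _]tvec0 // scaler0 subr0 subrr.
have SE' : S *m E = E' *m S.
  apply/subr0_eq; apply: (shift_lower_generate (P := q ^- 2 *: X') (Q := Y')).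
  - rewrite mulmxBl mulmxBr -!mulmxA SX raise_shift // !mulmxA raise_shift' //.
    rewrite !(mulmxDr, mulmxDl) mulmxN mulNmx -!scalemxAr -!scalemxAl -/k -/k' Sk.
    rewrite scalar_mxC !mulmxA SX.
    by rewrite opprD addrACA subrr addr0 opprD addrACA subrr addr0.
  - rewrite mulmxBl mulmxBr -!mulmxA urepEm SY (mulmxA E') urepEm mulmxDr mulmxDl.
    rewrite -scalemxAr -scalemxAl mulmxBr mulmxBl SK SKV mulmxA SY -!mulmxA.
    by rewrite opprD addrACA subrr addr0.
  - rewrite mulmxBl -!mulmxA S00 !tens_raise !(@tvec0 _ _ _ (0 - 1)) //.
    by rewrite !(@tvec0 _ _ _ _ (0 - 1)) // !scaler0 !addr0 mulmx0 subr0.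
exists S; split=> //; first exact: calU_linearP.
apply: contraTneq isT => S_0; have := congr1 (fun v => coef v 0 0) S00.
rewrite S_0 mul0mx [RHS]coef_tvec // eqxx mulr1 /coef mulmx0 mxE => /esym/eqP.
by rewrite oner_eq0.
Qed.

End Exchange.


(** * The coefficients of the intertwiner *)

Section Main.
Variables (F : fieldType) (q : F) (hq : q_generic q) (l m : nat) (a : F).
Local Notation T := (VW hq l m a).
Local Notation T' := (WV hq l m a).
Local Notation X := (shift q l m a).
Local Notation X' := (shift' q l m a).
Local Notation x nu := (lowest_vec q l m nu).
Local Notation x' nu := (lowest_vec q m l nu).

Definition Rcoef (nu : nat) : F :=
  (-1) ^+ nu * q ^- (nu * (l + m - nu + 1)).

Lemma Rcoef0 : Rcoef 0 = 1. Proof. by rewrite /Rcoef mul0n expr0 mul1r invr1. Qed.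

Lemma RcoefS nu : (nu < minn l m)%N ->
  Rcoef nu.+1 * - q ^ (l%:Z + m%:Z - 2 * nu%:Z) = Rcoef nu.
Proof.
move=> nulm; have qV (n : nat) : q ^- n = q ^ (- n%:Z) by rewrite qexpzN.
rewrite /Rcoef !qV.
have -> : - (nu * (l + m - nu + 1))%N%:Z =
  - (nu.+1 * (l + m - nu.+1 + 1))%N%:Z + (l%:Z + m%:Z - 2 * nu%:Z) by nia.
by rewrite (qexpzD hq (- _) (_ + _ - _)) exprS; ring.
Qed.

Lemma lowest_x nu : (nu <= minn l m)%N -> lowest T (l + m - 2 * nu)%N%:Z (x nu).
Proof.
move=> nulm; have := lowest_vec_lowest hq a 0 nulm; congr lowest; lia.
Qed.

Lemma lowest_x' nu : (nu <= minn l m)%N -> lowest T' (l + m - 2 * nu)%N%:Z (x' nu).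
Proof.
rewrite minnC => nulm; have := lowest_vec_lowest hq 0 a nulm; congr lowest; lia.
Qed.

Lemma x'_neq0 nu : (nu <= minn l m)%N -> x' nu != 0.
Proof. by rewrite minnC; apply: lowest_vec_neq0. Qed.

Lemma x_unique nu y : (nu <= minn l m)%N -> lowest T (l + m - 2 * nu)%N%:Z y ->
  exists c, y = c *: x nu.
Proof.
move=> nulm ly; apply: (lowest_vec_unique (hq := hq) (a := a) (b := 0)) => //.
by move: ly; congr lowest; lia.
Qed.

Lemma x'_unique nu y : (nu <= minn l m)%N -> lowest T' (l + m - 2 * nu)%N%:Z y ->
  exists c, y = c *: x' nu.
Proof.
move=> nulm ly; apply: (lowest_vec_unique (hq := hq) (a := 0) (b := a)).
  by rewrite minnC.
by move: ly; congr lowest; lia.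
Qed.

Lemma VW_weighted : weighted T (l + m). Proof. exact: tens_weighted. Qed.
Lemma WV_weighted : weighted T' (l + m).
Proof. by rewrite addnC; exact: tens_weighted. Qed.

Lemma eq0_on_lowest f : calU_linear T T' f ->
  (forall nu, (nu <= minn l m)%N -> f *m x nu = 0) -> f = 0.
Proof.
move=> fU fx; apply: (linear_eq0 hq VW_weighted WV_weighted fU) => nu y nuB ly.
have [nulm|lmnu] := leqP nu (minn l m).
  have [|c ->] := x_unique (y := y) nulm; last by rewrite -scalemxAr fx ?scaler0.
  by move: ly; congr lowest; lia.
suff -> : y = 0 by rewrite mulmx0.
by apply: (lowest_big (hq := hq) (a := a) (b := 0) lmnu); move: ly; congr lowest; lia.
Qed.

(** The shift carries the lowest weight vector of index [nu + 1] to the one of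
    index [nu] in the source, and to [- q ^ (l + m - 2 nu)] times the one of index
    [nu] in the target; this fixes the ratio of consecutive coefficients. *)
Lemma shift_linear f : calU_linear T T' f -> f *m X = X' *m f ->
  exists c, forall nu, (nu <= minn l m)%N -> f *m x nu = (c * Rcoef nu) *: x' nu.
Proof.
move=> fU fX; have fx nu : (nu <= minn l m)%N -> exists c, f *m x nu = c *: x' nu.
  by move=> nulm; exact: (x'_unique nulm (linear_lowest fU (lowest_x nulm))).
have [c fx0] := fx 0%N isT; exists c.
elim=> [|nu IH] nulm; first by rewrite Rcoef0 mulr1.
have [d fd] := fx _ nulm; rewrite fd; congr (_ *: _).
have : f *m (X *m x nu.+1) = X' *m (f *m x nu.+1) by rewrite !mulmxA fX.
rewrite shift_low // IH ?(ltnW nulm) // fd -scalemxAr shift'_low // scalerA.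
rewrite -(RcoefS nulm) => /eqP; rewrite -subr_eq0 -scalerBl scaler_eq0.
rewrite (negPf (x'_neq0 (ltnW nulm))) orbF mulrA -mulrBl mulf_eq0 oppr_eq0.
by rewrite (negPf (qexpz_neq0 hq _)) orbF subr_eq0 => /eqP.
Qed.

(** The components [Rn nu] exist as soon as some map has nonzero coefficients on
    all the lowest weight vectors. *)
Lemma Rn_spec f c : calU_linear T T' f ->
  (forall nu, (nu <= minn l m)%N -> f *m x nu = (c * Rcoef nu) *: x' nu) ->
  c != 0 -> forall nu, (nu <= minn l m)%N -> is_Rn hq a nu (Rn hq l m a nu).
Proof.
move=> fU fx c0 nu nulm; rewrite /Rn; case: xgetP => [f' _ //|/= noR].
have [||||||||g [gU gV gx]] := linear_component (nu := nu)
  (n := (l + m - 2 * nu)%N) (x := x nu) (x' := x' nu) (c := c * Rcoef nu)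
  hq VW_weighted WV_weighted fU.
- by lia.
- by [].
- exact: lowest_x.
- exact: lowest_x'.
- exact: x'_neq0.
- by move=> y; exact: x'_unique.
- exact: fx.
- rewrite mulf_neq0 // /Rcoef mulf_neq0 ?signr_eq0 // invr_eq0.
  by rewrite expf_neq0 // q_neq0.
by case: (noR g).
Qed.

(** For [mu != nu], the image is a multiple of [x' mu] in the irreducible
    component of [x' nu], where the Casimir has another value. *)
Lemma Rn_lowest nu mu : (nu <= minn l m)%N -> (mu <= minn l m)%N ->
  is_Rn hq a nu (Rn hq l m a nu) ->
  Rn hq l m a nu *m x mu = if mu == nu then x' nu else 0.
Proof.
move=> nulm mulm [RU RV Rx]; case: eqVneq => [->//|munu].
have [c Rc] : exists c, Rn hq l m a nu *m x mu = c *: x' mu.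
  exact: (x'_unique mulm (linear_lowest RU (lowest_x mulm))).
have := RV (x mu); rewrite (Vtilde_cyclic hq WV_weighted (lowest_x' nulm)) //;
  [|exact: x'_neq0|by move=> y; exact: x'_unique].
move=> /(cyclic_cas hq (lowest_x' nulm)); rewrite Rc -scalemxAr.
rewrite (cas_low hq (lowest_x' mulm)) !scalerA [c * _]mulrC => /eqP.
rewrite -subr_eq0 -scalerBl -mulrBl scaler_eq0 (negPf (x'_neq0 mulm)) orbF.
rewrite mulf_eq0 subr_eq0 (negPf (cas_val_neq hq _ _)); [|by lia|by lia].
by move=> /eqP ->; rewrite scale0r.
Qed.

Lemma calU_linearB f g c : calU_linear T T' f -> calU_linear T T' g ->
  calU_linear T T' (f - c *: g).
Proof.
move=> fU gU u uU; rewrite mulmxBl mulmxBr fU // -scalemxAl gU //.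
by rewrite -scalemxAr.
Qed.

Lemma calU_linear_sum (I : finType) (c : I -> F) (f : I -> 'M[F]_(_, _)) :
  (forall i, calU_linear T T' (f i)) -> calU_linear T T' (\sum_i c i *: f i).
Proof.
move=> fU u uU; rewrite mulmx_suml mulmx_sumr; apply: eq_bigr => i _.
by rewrite -scalemxAl fU // -scalemxAr.
Qed.

(** [f] and [Rmx] have proportional coefficients on the lowest weight vectors,
    which determine both. *)
Lemma Rmx_multiple f : calU_linear T T' f -> f *m X = X' *m f ->
  exists c, f = c *: Rmx hq l m a.
Proof.
have [S [SU SX S0]] := exchange_exists hq l m a.
have [d Sx] := shift_linear SU SX.
have d0 : d != 0.
  apply: contraNneq S0 => d0; apply/eqP/(eq0_on_lowest SU) => nu nulm.
  by rewrite Sx // d0 mul0r scale0r.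
have RnP nu : (nu < (minn l m).+1)%N -> is_Rn hq a nu (Rn hq l m a nu).
  exact: (Rn_spec SU Sx d0).
have RU : calU_linear T T' (Rmx hq l m a).
  by apply: calU_linear_sum => nu; case: (RnP nu (ltn_ord nu)).
have Rx nu : (nu <= minn l m)%N -> Rmx hq l m a *m x nu = Rcoef nu *: x' nu.
  move=> nulm; rewrite /Rmx mulmx_suml.
  rewrite (bigD1 (Ordinal (nulm : (nu < (minn l m).+1)%N))) //= big1 ?addr0.
    by rewrite -scalemxAl Rn_lowest ?eqxx //; exact: RnP.
  move=> mu; rewrite -val_eqE /= => munu; have mulm := ltn_ord mu.
  rewrite -scalemxAl Rn_lowest // ?[_ == (mu : nat)]eq_sym ?(negPf munu) ?scaler0 //.
  exact: RnP.
move=> fU fX; have [c fx] := shift_linear fU fX; exists c.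
apply/subr0_eq/eq0_on_lowest; first exact: calU_linearB.
by move=> nu nulm; rewrite mulmxBl -scalemxAl Rx // fx // scalerA subrr.
Qed.

End Main.

Theorem theorem3 (R : realType) (q : R[i]) (hq : q_generic q)
    (l m : nat) (l_gt0 : (0 < l)%N) (m_gt0 : (0 < m)%N)
    (a : R[i]) (a_neq0 : a != 0) :
  intertwiner (VW hq l m a) (WV hq l m a) (Rmx hq l m a) /\
  forall S, intertwiner (VW hq l m a) (WV hq l m a) S ->
    exists c : R[i], S = c *: Rmx hq l m a.
Proof.
have aq0 : a * q != 0 by exact: mulf_neq0 a_neq0 (q_neq0 hq).
split=> [|S [_ ST]]; last first.
  apply: Rmx_multiple => [u _|]; first exact: ST.
  have := ST (ugen q (GE false)); rewrite VW_E0 WV_E0 -scalemxAr -scalemxAl.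
  by move/(scalerI aq0).
have [S [SU SX S0]] := exchange_exists hq l m a.
have [c Sc] := Rmx_multiple SU SX.
have [c0 R0] : c != 0 /\ Rmx hq l m a != 0.
  by apply/andP; rewrite -negb_or -scaler_eq0 -Sc.
have RS : Rmx hq l m a = c^-1 *: S by rewrite Sc scalerA mulVf ?scale1r.
apply: intertwinerP => //.
  by move=> u uU; rewrite RS -scalemxAl SU // -scalemxAr.
by rewrite VW_E0 WV_E0 -scalemxAr -scalemxAl RS -scalemxAl -scalemxAr SX.
Qed.
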